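(* For every $n\in\mathbb{Z}_{>0}$, let $\boldsymbol{\sigma}^n$ be a uniform random permutation in $\mathrm{Av}^n(231)$. There exists a random infinite rooted permutation $\boldsymbol{\sigma}^\infty_{231}$ such that $(\boldsymbol{\sigma}^n)$ converges in the quenched Benjamini--Schramm sense to the (deterministic) measure $\mathcal{L}(\boldsymbol{\sigma}^\infty_{231})$, the law of $\boldsymbol{\sigma}^\infty_{231}$.
   Context: All intervals $[a,b]$ are integer intervals. $\mathcal{S}^n$ is the set of permutations $\sigma=\sigma_1\cdots\sigma_n$ of $[n]=\{1,\dots,n\}$, $|\sigma|=n$ is the size, and $\mathcal{S}=\bigcup_{n\ge1}\mathcal{S}^n$. $\mathrm{Av}^n(231)$ is the set of permutations in $\mathcal{S}^n$ having no subsequence $\sigma_a,\sigma_b,\sigma_c$ with $a<b<c$ and $\sigma_c<\sigma_a<\sigma_b$. Rooted permutations. A finite rooted permutation is a pair $(\sigma,i)$ with $\sigma\in\mathcal{S}^n$, $i\in[n]$. It is identified with the pair $(A_{\sigma,i},\preccurlyeq_{\sigma,i})$, where $A_{\sigma,i}=[-i+1,|\sigma|-i]$ and $\preccurlyeq_{\sigma,i}$ is the total order on it given by $\ell\preccurlyeq_{\sigma,i}j\iff\sigma_{\ell+i}\le\sigma_{j+i}$; this is a bijection between finite rooted permutations and total orders on finite integer intervals containing $0$. An infinite rooted permutation is a pair $(A,\preccurlyeq)$ with $A$ an infinite integer interval containing $0$ and $\preccurlyeq$ a total order on $A$. $\tilde{\mathcal{S}}_\bullet$ is the set of all finite and infinite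 rooted permutations. For $h\in\mathbb{Z}_{>0}$, $r_h(A,\preccurlyeq)=(A\cap[-h,h],\preccurlyeq)$. The local distance on $\tilde{\mathcal{S}}_\bullet$ is $d(x,y)=2^{-\sup\{h\in\mathbb{Z}_{>0}:\,r_h(x)=r_h(y)\}}$, with $\sup\emptyset=0$, $\sup\mathbb{Z}_{>0}=+\infty$, $2^{-\infty}=0$. Quenched convergence: for a permutation $\sigma$, let $\mu_\sigma$ be the law of $(\sigma,\boldsymbol{i})$ with $\boldsymbol{i}$ uniform in $[|\sigma|]$, a probability measure on $\tilde{\mathcal{S}}_\bullet$. A sequence $(\boldsymbol{\sigma}^n)$ of random permutations converges in the quenched Benjamini--Schramm sense to a (possibly random) probability measure $\boldsymbol{\mu}$ on $\tilde{\mathcal{S}}_\bullet$ if the random measures $\mu_{\boldsymbol{\sigma}^n}$ converge in distribution to $\boldsymbol{\mu}$ with respect to the weak topology on probability measures on $(\tilde{\mathcal{S}}_\bullet,d)$. *)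

(* Defs.v *)
From HB Require Import structures.
From mathcomp Require Import all_boot all_order all_algebra all_fingroup.
From mathcomp Require Import all_classical all_reals all_analysis.
Set Implicit Arguments.
Unset Strict Implicit.
Unset Printing Implicit Defensive.
Import Order.TTheory GRing.Theory Num.Theory.
Import numFieldNormedType.Exports.
Local Open Scope classical_set_scope.
Local Open Scope ring_scope.

(** Permutations are 0-based: [sigma : 'S_n] acts on 'I_n = {0, ..., n - 1}
    instead of {1, ..., n}. *)

Definition Av231 (n : nat) : {set 'S_n} :=
  [set s : 'S_n | ~~ [exists a : 'I_n, exists b : 'I_n, exists c : 'I_n,
    [&& (a < b)%N, (b < c)%N, (s c < s a)%N & (s a < s b)%N]]]%SET.

(** All nonempty finite permutations; the component [n] stands for size
    [n.+1].  The sigma-algebra is the discrete one. *)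
Definition perms : Type := {n : nat & 'S_n.+1}.

Definition mkperms (n : nat) (s : 'S_n.+1) : perms :=
  existT (fun n : nat => 'S_n.+1) n s.

HB.instance Definition _ := Choice.copy perms {n : nat & 'S_n.+1}.
HB.instance Definition _ := isPointed.Build perms (@mkperms 0 1%g).
HB.instance Definition _ := @isMeasurable.Build default_measure_display
  perms discrete_measurable discrete_measurable0
  discrete_measurableC discrete_measurableU.

(** A rooted permutation, finite or infinite, is a total order on an integer
    interval containing 0.  [rp_le] is required to relate only elements of
    [rp_dom], so that Leibniz equality is equality of pairs (A, order). *)
Record rooted_perm := RootedPerm {
  rp_dom : set int ;
  rp_le : int -> int -> Prop ;
  rp_dom0 : rp_dom 0 ;
  rp_dom_itv : forall x y z : int,
    rp_dom x -> rp_dom z -> x <= y <= z -> rp_dom y ;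
  rp_le_dom : forall x y, rp_le x y -> rp_dom x /\ rp_dom y ;
  rp_le_refl : forall x, rp_dom x -> rp_le x x ;
  rp_le_anti : forall x y, rp_le x y -> rp_le y x -> x = y ;
  rp_le_trans : forall x y z, rp_le x y -> rp_le y z -> rp_le x z ;
  rp_le_total : forall x y, rp_dom x -> rp_dom y -> rp_le x y \/ rp_le y x }.

Definition rp_infinite (x : rooted_perm) : Prop := infinite_set (rp_dom x).

Lemma rooted_perm_eq (x y : rooted_perm) :
  rp_dom x = rp_dom y -> rp_le x = rp_le y -> x = y.
Proof.
case: x => A l p1 p2 p3 p4 p5 p6 p7; case: y => A' l' q1 q2 q3 q4 q5 q6 q7 /=.
move=> eA el; subst A' l'.
by congr RootedPerm; exact: Prop_irrelevance.
Qed.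

(** The finite rooted permutation (sigma, i).  With the 1-based root i + 1 the
    interval [-(i + 1) + 1, |sigma| - (i + 1)] is [-i, n - i] for |sigma| = n.+1. *)
Section rooting.
Variables (n : nat) (s : 'S_n.+1) (i : 'I_n.+1).

Definition root_dom : set int :=
  [set l : int | - i%:Z <= l <= n%:Z - i%:Z].

Definition root_le (l j : int) : Prop :=
  exists a b : 'I_n.+1,
    [/\ a%:Z = l + i%:Z, b%:Z = j + i%:Z & (s a <= s b)%N].

Let root_dom_ord (l : int) : root_dom l ->
  exists a : 'I_n.+1, a%:Z = l + i%:Z.
Proof.
rewrite /root_dom /= => /andP[h1 h2].
have h0 : 0 <= l + i%:Z by rewrite -lerBlDr sub0r.
have hn : (absz (l + i%:Z)%R < n.+1)%N.
  by rewrite ltnS -lez_nat gez0_abs// -lerBrDr.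
by exists (Ordinal hn); rewrite /= gez0_abs.
Qed.

Let root_ord_dom (a : 'I_n.+1) (l : int) : a%:Z = l + i%:Z -> root_dom l.
Proof.
move=> al; have -> : l = a%:Z - i%:Z by rewrite al addrK.
rewrite /root_dom /= lerD2r lez_nat -ltnS ltn_ord andbT.
by rewrite -[leLHS]add0r lerD2r.
Qed.

Let ord_Z_inj (a b : 'I_n.+1) (z : int) : a%:Z = z -> b%:Z = z -> a = b.
Proof. by move=> <- [] e; apply/val_inj. Qed.

Let root_dom0 : root_dom 0.
Proof. by apply: (@root_ord_dom i); rewrite add0r. Qed.

Let root_dom_itv (x y z : int) :
  root_dom x -> root_dom z -> x <= y <= z -> root_dom y.
Proof.
rewrite /root_dom /= => /andP[h1 _] /andP[_ h2] /andP[h3 h4].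
by rewrite (le_trans h1)//= (le_trans h4).
Qed.

Let root_le_dom x y : root_le x y -> root_dom x /\ root_dom y.
Proof. by move=> [a [b [ha hb _]]]; split; [exact: root_ord_dom ha|exact: root_ord_dom hb]. Qed.

Let root_le_refl x : root_dom x -> root_le x x.
Proof. by move=> /root_dom_ord[a ha]; exists a, a. Qed.

Let root_le_anti x y : root_le x y -> root_le y x -> x = y.
Proof.
move=> [a [b [ha hb ab]]] [b' [a' [hb' ha' ba]]].
rewrite (ord_Z_inj hb' hb) (ord_Z_inj ha' ha) in ba.
have sab : s a = s b by apply/val_inj/eqP; rewrite eqn_leq ab ba.
have e := perm_inj sab; subst b.
by apply: (addIr i%:Z); rewrite -ha -hb.
Qed.

Let root_le_trans x y z : root_le x y -> root_le y z -> root_le x z.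
Proof.
move=> [a [b [ha hb ab]]] [b' [c [hb' hc bc]]].
rewrite (ord_Z_inj hb' hb) in bc.
by exists a, c; split=> //; exact: leq_trans bc.
Qed.

Let root_le_total x y :
  root_dom x -> root_dom y -> root_le x y \/ root_le y x.
Proof.
move=> /root_dom_ord[a ha] /root_dom_ord[b hb].
by case/orP: (leq_total (s a) (s b)) => h; [left; exists a, b|right; exists b, a].
Qed.

Definition root_at : rooted_perm :=
  RootedPerm root_dom0 root_dom_itv root_le_dom root_le_refl root_le_anti
    root_le_trans root_le_total.

End rooting.

(** The restriction r_h to [-h, h]. *)
Section restriction.
Variables (h : nat) (x : rooted_perm).

Definition restr_dom : set int := rp_dom x `&` [set l : int | `|l| <= h%:Z].

Definition restr_le (l j : int) : Prop :=
  [/\ rp_le x l j, restr_dom l & restr_dom j].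

Let restr_dom0 : restr_dom 0.
Proof. by split; [exact: rp_dom0|rewrite /= normr0]. Qed.

Let restr_dom_itv (a b c : int) :
  restr_dom a -> restr_dom c -> a <= b <= c -> restr_dom b.
Proof.
move=> [a1 a2] [c1 c2] abc; split; first exact: rp_dom_itv a1 c1 abc.
move: a2 c2 abc => /=; rewrite !ler_norml => /andP[a2 _] /andP[_ c2] /andP[ab bc].
by rewrite (le_trans a2)//= (le_trans bc).
Qed.

Let restr_le_dom a b : restr_le a b -> restr_dom a /\ restr_dom b.
Proof. by case. Qed.

Let restr_le_refl a : restr_dom a -> restr_le a a.
Proof. by move=> ha; split=> //; apply: rp_le_refl; case: ha. Qed.

Let restr_le_anti a b : restr_le a b -> restr_le b a -> a = b.
Proof. by move=> [ab _ _] [ba _ _]; exact: rp_le_anti ab ba. Qed.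

Let restr_le_trans a b c : restr_le a b -> restr_le b c -> restr_le a c.
Proof. by move=> [ab ? _] [bc _ ?]; split=> //; exact: rp_le_trans ab bc. Qed.

Let restr_le_total a b :
  restr_dom a -> restr_dom b -> restr_le a b \/ restr_le b a.
Proof.
move=> ha hb.
have [ab|ba] := rp_le_total (proj1 ha) (proj1 hb); [left|right]; by split.
Qed.

Definition restr : rooted_perm :=
  RootedPerm restr_dom0 restr_dom_itv restr_le_dom restr_le_refl restr_le_anti
    restr_le_trans restr_le_total.

End restriction.

Lemma restr_restr (k h : nat) (x : rooted_perm) :
  (k <= h)%N -> restr k (restr h x) = restr k x.
Proof.
move=> kh.
have dE : restr_dom k (restr h x) = restr_dom k x.
  apply/seteqP; split=> [l [[? _] ?]//|l [? lk]]; split=> //; split=> //=.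
  by rewrite (le_trans lk)// lez_nat.
apply: rooted_perm_eq => //=; apply/funext => a; apply/funext => b.
rewrite /restr_le dE; apply/propext; split=> [[[? _ _] ? ?]//|[ab [a1 a2] [b1 b2]]].
by split=> //; split=> //; split=> //=; [rewrite (le_trans a2)|rewrite (le_trans b2)];
  rewrite // lez_nat.
Qed.

Lemma restr_mono (k h : nat) (x y : rooted_perm) :
  (k <= h)%N -> restr h x = restr h y -> restr k x = restr k y.
Proof. by move=> kh e; rewrite -(restr_restr x kh) e restr_restr. Qed.

Lemma restr0 (x y : rooted_perm) : restr 0 x = restr 0 y.
Proof.
have d0 z : restr_dom 0 z = [set 0].
  apply/seteqP; split=> [l [_ /=]|l /= ->]; first by rewrite normr_le0 => /eqP.
  by split; [exact: rp_dom0|rewrite /= normr0].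
apply: rooted_perm_eq; rewrite /= ?d0//.
apply/funext => a; apply/funext => b; rewrite /restr_le !d0 /=.
apply/propext; split=> -[_ -> ->]; split=> //; exact/rp_le_refl/rp_dom0.
Qed.

Lemma restr_all_eq (x y : rooted_perm) :
  (forall h, restr h x = restr h y) -> x = y.
Proof.
move=> e.
have dE : rp_dom x = rp_dom y.
  apply/seteqP; split=> l hl.
    have : restr_dom `|l|%N x l by split=> //=; rewrite abszE.
    by rewrite -[restr_dom _ _]/(rp_dom (restr _ _)) e => -[].
  have : restr_dom `|l|%N y l by split=> //=; rewrite abszE.
  by rewrite -[restr_dom _ _]/(rp_dom (restr _ _)) -e => -[].
apply: rooted_perm_eq => //.
have sub (u v : rooted_perm) : (forall h, restr h u = restr h v) ->
    forall a b, rp_le u a b -> rp_le v a b.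
  move=> uv a b ab; have [ua ub] := rp_le_dom ab.
  pose h := maxn `|a|%N `|b|%N.
  have : rp_le (restr h u) a b.
    by split=> //; split=> //=; rewrite -abszE lez_nat leq_max leqnn ?orbT.
  by rewrite uv => -[].
by apply/funext => a; apply/funext => b; apply/propext; split; apply: sub.
Qed.

Section local_distance.
Variable R : realType.

(** [0] is adjoined so that the supremum of the empty set is 0 rather than
    the value -oo given by [ereal_sup]. *)
Definition agree_sup (x y : rooted_perm) : \bar R :=
  ereal_sup ([set h%:R%:E | h in
    [set h : nat | (0 < h)%N /\ restr h x = restr h y]] `|` [set 0%:E]).

Definition local_dist (x y : rooted_perm) : R :=
  if agree_sup x y == +oo%E then 0 else 2 `^ (- fine (agree_sup x y)).

Lemma local_distP (x y : rooted_perm) :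
  (x = y /\ local_dist x y = 0) \/
  exists h : nat, [/\ forall k, restr k x = restr k y <-> (k <= h)%N &
                      local_dist x y = 2 `^ (- h%:R)].
Proof.
have [e|] := pselect (forall h, restr h x = restr h y).
  left; split; first exact: restr_all_eq.
  rewrite /local_dist; case: eqP => // -[].
  apply/eqyP => r r0; apply: (@le_trans _ _ (Num.bound r)%:R%:E).
  - by rewrite lee_fin ltW// archi_boundP// ltW.
  - apply: ereal_sup_ubound; case: (posnP (Num.bound r)) => [->|b0]; first by right.
    by left; exists (Num.bound r).
move=> /existsNP[h0 /asboolPn nh0]; right.
have ex : exists h, ~~ `[< restr h x = restr h y >] by exists h0.
case: (ex_minnP ex) => -[|h] /asboolP nh hmin; first by case: nh; exact: restr0.
have hP k : restr k x = restr k y <-> (k <= h)%N.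
  split=> [e|kh].
    by rewrite leqNgt; apply/negP => hk; apply: nh; exact: restr_mono e.
  apply: contrapT => /asboolPn /hmin.
  by rewrite ltnNge kh.
exists h; split=> //.
suff sE : agree_sup x y = h%:R%:E by rewrite /local_dist sE.
apply/eqP; rewrite eq_le; apply/andP; split.
  apply: ge_ereal_sup => _ [[k [_ /hP kh] <-]|->]; rewrite lee_fin ?ler_nat//.
apply: ereal_sup_ubound; case: (posnP h) => [->|h_gt0]; first by right.
by left; exists h => //; split=> //; exact/hP.
Qed.

End local_distance.

(** The carrier does not depend on [R]; the parameter only fixes the field in
    which the local distance takes its values. *)
Definition rooted (R : realType) : Type := rooted_perm.

HB.instance Definition _ (R : realType) := gen_eqMixin (rooted R).
HB.instance Definition _ (R : realType) := gen_choiceMixin (rooted R).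
HB.instance Definition _ (R : realType) :=
  isPointed.Build (rooted R) (root_at (1%g : 'S_1) ord0).

Section rooted_metric.
Variable R : realType.

Let distxx (x : rooted R) : local_dist R x x = 0.
Proof.
have [[]//|[h [hP _]]] := local_distP R x x.
by have /hP := erefl (restr h.+1 x); rewrite ltnn.
Qed.

Let dist_ge0 (x y : rooted R) : 0 <= local_dist R x y.
Proof. by rewrite /local_dist; case: ifP => // _; exact: powR_ge0. Qed.

Let dist_pos (x y : rooted R) : local_dist R x y = 0 -> x = y.
Proof.
have [[]//|[h [_ ->]]] := local_distP R x y => /eqP.
by rewrite gt_eqF// powR_gt0.
Qed.

Let dist_sym (x y : rooted R) : local_dist R x y = local_dist R y x.
Proof.
rewrite /local_dist; suff -> : agree_sup R x y = agree_sup R y x by [].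
congr (ereal_sup (_ `|` _)); congr (_ @` _).
by apply/seteqP; split=> h [].
Qed.

Let dist_triangle (y x z : rooted R) :
  local_dist R x z <= local_dist R x y + local_dist R y z.
Proof.
have [[_ ->]|[h [hP ->]]] := local_distP R x z; first by rewrite addr_ge0.
have main (u v : rooted R) : restr h.+1 u <> restr h.+1 v ->
    2 `^ (- h%:R) <= local_dist R u v.
  move=> nuv; have [[uv _]|[k [kP ->]]] := local_distP R u v.
    by case: nuv; rewrite uv.
  apply: ler_powR; first by rewrite ler1n.
  rewrite lerN2 ler_nat -ltnS ltnNge; apply/negP => hk; exact/nuv/kP.
have [xy|xy] := pselect (restr h.+1 x = restr h.+1 y); last first.
  by rewrite (le_trans (main _ _ xy))// lerDl.
apply: (le_trans (main y z _)); last by rewrite lerDr.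
by rewrite -xy => /hP; rewrite ltnn.
Qed.

HB.instance Definition _ := @isMetric.Build R (rooted R)
  (@local_dist R) distxx dist_pos dist_sym dist_triangle.

End rooted_metric.

Definition borel (E : ptopologicalType) := g_sigma_algebraType (@open E).

Definition Cb (R : realType) (E : topologicalType) : Type :=
  {f : E -> R | continuous f /\ [bounded f x | x in [set: E]]}.

HB.instance Definition _ (R : realType) (E : topologicalType) :=
  gen_eqMixin (Cb R E).

(** Weak topology on probability measures: the coarsest one making the
    integration of every bounded continuous function continuous. *)
Definition weak_prob (R : realType) (E : ptopologicalType) : Type :=
  initial_topology (fun (mu : probability (borel E) R) =>
    (fun f : Cb R E => \int[mu]_x (sval f) x) : {ptws Cb R E -> R}).

HB.instance Definition _ (R : realType) (E : ptopologicalType) :=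
  PointedTopological.copy (weak_prob R E)
    (initial_topology (fun (mu : probability (borel E) R) =>
      (fun f : Cb R E => \int[mu]_x (sval f) x) : {ptws Cb R E -> R})).

(** Convergence in distribution of random elements of E, which may live on
    different probability spaces. *)
Definition cvg_in_dist (R : realType) (E : ptopologicalType)
    (d_ : nat -> measure_display) (T_ : forall n, measurableType (d_ n))
    (P_ : forall n, probability (T_ n) R)
    (X_ : forall n, {RV (P_ n) >-> borel E})
    (d : measure_display) (T : measurableType d) (P : probability T R)
    (X : {RV P >-> borel E}) : Prop :=
  forall F : E -> R, continuous F -> [bounded F x | x in [set: E]] ->
    ('E_(P_ n)[fun w => F (X_ n w)] @[n --> \oo] --> 'E_P[fun w => F (X w)])%E.

Section root_law.
Variables (R : realType) (s : perms).

(** The law of (sigma, i) with i uniform. *)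
Definition root_law (A : set (borel (rooted R))) : \bar R :=
  (((tag s).+1%:R^-1 : R)%:E *
   \sum_(i < (tag s).+1) \d_(root_at (tagged s) i : borel (rooted R)) A)%E.

Let nu : {measure set (borel (rooted R)) -> \bar R} :=
  mscale ((tag s).+1%:R^-1 : R)%:nng
    (msum (fun k : nat => \d_(root_at (tagged s) (inord k) : borel (rooted R)))
          (tag s).+1).

Let root_lawE : root_law = nu.
Proof.
apply/funext => A; rewrite /root_law /nu /= /mscale /= /msum /=.
by congr (_ * _)%E; apply: eq_bigr => i _; rewrite inord_val.
Qed.

Let root_law0 : root_law set0 = 0%E.
Proof. by rewrite root_lawE measure0. Qed.

Let root_law_ge0 A : (0 <= root_law A)%E.
Proof. by rewrite root_lawE. Qed.

Let root_law_sigma_additive : semi_sigma_additive root_law.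
Proof. by rewrite root_lawE; exact: measure_semi_sigma_additive. Qed.

HB.instance Definition _ := isMeasure.Build _ _ _ root_law
  root_law0 root_law_ge0 root_law_sigma_additive.

Let root_lawT : root_law setT = 1%E.
Proof.
rewrite /root_law (eq_bigr (fun=> 1%:E)) => [|i _]; last by rewrite diracT.
by rewrite sumEFin sumr_const card_ord -EFinM mulVf.
Qed.

HB.instance Definition _ := Measure_isProbability.Build _ _ _ root_law root_lawT.

End root_law.

Section random_root_law.
Variable R : realType.

(** [root_law] as a point of the space of probability measures. *)
Definition random_root_law (s : perms) : borel (weak_prob R (rooted R)) :=
  (root_law s : probability (borel (rooted R)) R).

Lemma measurable_random_root_law :
  measurable_fun [set: perms] random_root_law.
Proof. by []. Qed.

HB.instance Definition _ := isMeasurableFun.Build _ _ _ _ random_root_law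
  measurable_random_root_law.

End random_root_law.

(** Quenched Benjamini--Schramm convergence of random permutations [sigma_ n]
    to a random probability measure [mu] on rooted permutations. *)
Definition quenched_cvg (R : realType)
    (d_ : nat -> measure_display) (T_ : forall n, measurableType (d_ n))
    (P_ : forall n, probability (T_ n) R)
    (sigma_ : forall n, {RV (P_ n) >-> perms})
    (d : measure_display) (T : measurableType d) (P : probability T R)
    (mu : {RV P >-> borel (weak_prob R (rooted R))}) : Prop :=
  @cvg_in_dist R _ d_ T_ P_
    (fun n => (@random_root_law R \o sigma_ n : {mfun _ >-> _})) d T P mu.

Definition uniform_in (R : realType) (n : nat) (A : {set 'S_n.+1})
    (d : measure_display) (T : measurableType d) (P : probability T R)
    (X : {RV P >-> perms}) : Prop :=
  forall B : set perms,
    P (X @^-1` B) =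
      (#|[set s in A | `[< B (mkperms s) >]]%SET|%:R / #|A|%:R)%:E.

(* Main.v *)
Require Import Defs.
From HB Require Import structures.
From mathcomp Require Import all_boot all_order all_algebra all_fingroup.
From mathcomp Require Import all_classical all_reals all_analysis.
From mathcomp Require Import measurable_realfun.
From mathcomp Require Import zify ring lra.
Import Order.TTheory GRing.Theory Num.Theory.
Import numFieldNormedType.Exports.
Local Open Scope classical_set_scope.
Local Open Scope ring_scope.
Set Implicit Arguments.
Unset Strict Implicit.
Unset Printing Implicit Defensive.

(** A 231-avoiding permutation is exactly a stack-sortable one. If [d j] is the
    number of elements popped between the pushes of the entries [j] and [j + 1],
    then for [a < b] one has [s a < s b] iff [a] is popped before [b] is pushed,
    that is, iff [m <= d a + ... + d (a + m - 1)] for some [0 < m <= b - a].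
    So the order seen in a window of radius [h] is a function of the [2 h] numbers
    [d] there, and only of their truncations at [2 h].

    By the cycle lemma, a uniform 231-avoiding permutation of size [n] is the unique
    good rotation of a uniform composition of [n] into [n + 1] parts. Averages of
    window functions along the cycle are rotation invariant, so they can be computed
    on compositions, where the event [x i >= c i for all i] has probability
    C(2 n - sum c, n) / C(2 n, n), which tends to [2 ^ - sum c]. Applied to pairs of
    windows this gives a second moment estimate: the averages converge in L2 to the
    means for a sequence of independent geometric variables of parameter 1/2.

    The limit is therefore the order coded by such a sequence indexed by the
    integers; it is realized on [0, 1[ with Lebesgue measure by cutting the binary
    digits into infinitely many independent sequences and counting leading ones. *)

(** * The order coded by a sequence *)

(** In the stack reading, [a] lies under the [m - 1] entries pushed after it, so it is gone once [m]
    pops have occurred since its push. *)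
Definition overtakes (d : int -> nat) (a b : int) : Prop :=
  exists m : nat,
    [/\ (0 < m)%N, a + m%:Z <= b & (m <= \sum_(k < m) d (a + k%:Z)%R)%N].

Lemma over_mono (d : int -> nat) a b c : b <= c -> overtakes d a b -> overtakes d a c.
Proof. by move=> bc [m [m0 mb md]]; exists m; split => //; lia. Qed.

(** If [a] is still on the stack when [b] is pushed, and [b] when [c] is, then so is [a]: a stretch
    from [a] reaching beyond [b] splits at [b] into two stretches, each with fewer pops than
    pushes. *)
Lemma not_over_trans (d : int -> nat) a b c : a < b -> b < c ->
  ~ overtakes d a b -> ~ overtakes d b c -> ~ overtakes d a c.
Proof.
move=> ab bc nab nbc [m [m0 mc md]].
have [mb|bm] := leP (a + m%:Z) b; first by apply: nab; exists m.
have [p [q [pE mE p0 q0]]] : exists p q : nat,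
    [/\ b = a + p%:Z, m = (p + q)%N, (0 < p)%N & (0 < q)%N].
  by exists (absz (b - a)), (m - absz (b - a)%R)%N; split; lia.
have h1 : (\sum_(k < p) d (a + k%:Z)%R < p)%N.
  rewrite ltnNge; apply/negP => h; apply: nab; exists p; split=> //; lia.
have h2 : (\sum_(k < q) d (b + k%:Z)%R < q)%N.
  rewrite ltnNge; apply/negP => h; apply: nbc; exists q; split=> //; lia.
move: md; rewrite mE big_split_ord /= leqNgt => /negP; apply.
under [X in (_ + X < _)%N]eq_bigr => k _ do rewrite PoszD addrA -pE.
by rewrite -addnS; apply: leq_add => //; exact: ltnW.
Qed.

Definition walk_le (d : int -> nat) (a b : int) : Prop :=
  [\/ a = b, a < b /\ overtakes d a b | b < a /\ ~ overtakes d b a].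

Lemma walk_le_total d a b : walk_le d a b \/ walk_le d b a.
Proof.
case: (ltgtP a b) => [ab|ba|->]; last by left; constructor 1.
- by have [h|h] := pselect (overtakes d a b); [left; constructor 2|right; constructor 3].
- by have [h|h] := pselect (overtakes d b a); [right; constructor 2|left; constructor 3].
Qed.

Lemma walk_le_anti d a b : walk_le d a b -> walk_le d b a -> a = b.
Proof. by case=> [->//|[ab h]|[ab h]] [->//|[ba h']|[ba h']] //; lia. Qed.

(** [overtakes d a b] is monotone in [b], and its negation is transitive along increasing positions;
    every case reduces to these two facts. *)
Lemma walk_le_trans d a b c : walk_le d a b -> walk_le d b c -> walk_le d a c.
Proof.
case=> [->//|[ab hab]|[ba hba]] [<-|[bc hbc]|[cb hcb]].
- by constructor 2.
- by constructor 2; split; [exact: lt_trans bc|apply: over_mono hab; exact: ltW].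
- case: (ltgtP a c) => [ac|ca|->]; last by constructor 1.
    constructor 2; split=> //; apply: contrapT => nac.
    exact: (not_over_trans ac cb nac hcb hab).
  constructor 3; split=> // h; apply: hcb; apply: over_mono h; exact: ltW.
- by constructor 3.
- case: (ltgtP a c) => [ac|ca|->]; last by constructor 1.
    constructor 2; split=> //; apply: contrapT => nac.
    exact: (not_over_trans ba ac hba nac hbc).
  constructor 3; split=> // h; apply: hba; apply: over_mono hbc; exact: ltW.
- by constructor 3; split; [exact: lt_trans ba|exact: (not_over_trans cb ba)].
Qed.

Definition walk_rp (d : int -> nat) : rooted_perm :=
  @RootedPerm setT (walk_le d) I (fun _ _ _ _ _ _ => I)
    (fun _ _ _ => conj I I) (fun x _ => Or31 _ _ (erefl x)) (@walk_le_anti d)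
    (@walk_le_trans d) (fun _ _ _ _ => @walk_le_total d _ _).

Lemma walk_rp_infinite d : rp_infinite (walk_rp d).
Proof.
move=> /= finT; apply: infinite_nat.
by rewrite -(preimage_setT Posz); apply: finite_preimage finT => x y _ _ [].
Qed.

(** Either some term alone reaches [K >= m], and both sides hold, or nothing is truncated. *)
Lemma leq_sum_minn (I : finType) (d : I -> nat) (K m : nat) : (m <= K)%N ->
  (m <= \sum_k minn (d k) K)%N = (m <= \sum_k d k)%N.
Proof.
move=> mK; apply/idP/idP => [h|h].
  by apply: (leq_trans h); apply: leq_sum => k _; exact: geq_minl.
have [/existsP[k Kk]|/existsPn lt] := boolP [exists k, (K <= d k)%N].
  by rewrite (bigD1 k)//= (minn_idPr Kk) (leq_trans mK)// leq_addr.
rewrite (eq_bigr d)// => k _; apply/minn_idPl; move: (lt k); lia.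
Qed.

(* Only sums of at most [2 h] terms against [m <= 2 h] are compared inside a
   window of radius [h], so larger values of [d] may be truncated. *)
Lemma restr_walk_rp (h : nat) (d d' : int -> nat) :
  (forall t, - h%:Z <= t < h%:Z -> minn (d t) h.*2 = minn (d' t) h.*2) ->
  restr h (walk_rp d) = restr h (walk_rp d').
Proof.
move=> dd'.
have overE (a b : int) : `|a| <= h%:Z -> `|b| <= h%:Z -> overtakes d a b <-> overtakes d' a b.
  move=> ah bh.
  have E m : a + m%:Z <= b ->
      (m <= \sum_(k < m) d (a + k%:Z)%R)%N = (m <= \sum_(k < m) d' (a + k%:Z)%R)%N.
    move=> mb; rewrite -(@leq_sum_minn _ _ h.*2); last by lia.
    rewrite -[RHS](@leq_sum_minn _ _ h.*2); last by lia.
    congr (_ <= _)%N; apply: eq_bigr => k _; apply: dd'; by move: (ltn_ord k); lia.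
  by split=> -[m [m0 mb md]]; exists m; split=> //; rewrite ?E// -E.
apply: rooted_perm_eq => //=; apply/funext => a; apply/funext => b.
apply/propext; rewrite /restr_le /=; split=> -[ab [_ ah] [_ bh]]; split=> //; case: ab.
- by move=> ->; constructor 1.
- by move=> [? /overE?]; constructor 2; split=> //; tauto.
- by move=> [? /overE?]; constructor 3; split=> //; tauto.
- by move=> ->; constructor 1.
- by move=> [? /overE?]; constructor 2; split=> //; tauto.
- by move=> [? /overE?]; constructor 3; split=> //; tauto.
Qed.

(** The bounds on [i] put the whole window [[-h, h]] inside the domain, so that only comparisons
    have to be matched. *)
Lemma restr_root_at (h n : nat) (s : 'S_n.+1) (i : 'I_n.+1) (d : int -> nat) :
  (h <= i)%N -> (i + h <= n)%N ->
  (forall a b : 'I_n.+1, (a < b)%N ->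
     (s a < s b)%N <-> overtakes d (a%:Z - i%:Z) (b%:Z - i%:Z)) ->
  restr h (root_at s i) = restr h (walk_rp d).
Proof.
move=> hi ih sd.
have dom (l : int) : `|l| <= h%:Z -> root_dom i l by rewrite /root_dom /=; lia.
have leE (a b : int) : `|a| <= h%:Z -> `|b| <= h%:Z -> root_le s i a b <-> walk_le d a b.
  move=> ah bh.
  have [u ua] : exists u : 'I_n.+1, a = u%:Z - i%:Z.
    have p : (absz (a + i%:Z)%R < n.+1)%N by lia.
    by exists (Ordinal p) => /=; lia.
  have [v vb] : exists v : 'I_n.+1, b = v%:Z - i%:Z.
    have p : (absz (b + i%:Z)%R < n.+1)%N by lia.
    by exists (Ordinal p) => /=; lia.
  have -> : root_le s i a b <-> (s u <= s v)%N.
    split=> [[u' [v' [hu hv]]]|uv]; last by exists u, v; split=> //; lia.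
    have -> : u' = u by apply/val_inj => /=; lia.
    by have -> : v' = v by apply/val_inj => /=; lia.
  case: (ltngtP u v) => uv.
  - have := sd _ _ uv; rewrite -ua -vb => uvE.
    have neq : s u != s v by apply: contraTneq uv => /perm_inj ->; rewrite ltnn.
    rewrite leq_eqVlt; have -> /= : (s u == s v :> nat) = false by exact: negbTE.
    by rewrite uvE; split=> [h0|[|[]|[]]//]; [constructor 2; split=> //|..]; lia.
  - have := sd _ _ uv; rewrite -ua -vb => uvE.
    rewrite leqNgt; split=> [/negP h0|].
      by constructor 3; split; [lia|rewrite -uvE].
    by case=> [|[]|[_ ?]]; [lia|lia|apply/negP; rewrite uvE].
  - have -> : u = v by exact/val_inj.
    by rewrite leqnn; split=> // _; constructor 1; lia.
have dE : rp_dom (restr h (root_at s i)) = rp_dom (restr h (walk_rp d)).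
  by apply/seteqP; split=> l /= [h1 h2]; split => //=; exact: dom.
apply: rooted_perm_eq => //; apply/funext => a; apply/funext => b; apply/propext.
split=> -[/= ab [_ ah] [_ bh]]; split=> /=; rewrite ?leE//; try by split.
- by apply/leE.
- by split=> //=; exact: dom.
- by split=> //=; exact: dom.
Qed.

(** * Coding 231-avoiding permutations *)

(** The periodic extension of [x]: [inZp] reduces the index modulo [n.+1]. Values in ['I_n.+1]
    suffice for parts of a composition of [n]. *)
Definition cyc (n : nat) (x : {ffun 'I_n.+1 -> 'I_n.+1}) (j : nat) : nat :=
  x (inZp j).

Definition psum (d : nat -> nat) (j : nat) : nat := (\sum_(k < j) d k)%N.

Lemma psumS d j : psum d j.+1 = (psum d j + d j)%N.
Proof. by rewrite /psum big_ord_recr. Qed.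

Lemma psumD d i j : psum d (i + j) = (psum d i + \sum_(k < j) d (i + k))%N.
Proof. by rewrite /psum big_split_ord. Qed.

Definition compositions (n : nat) : {set {ffun 'I_n.+1 -> 'I_n.+1}} :=
  [set x | psum (cyc x) n.+1 == n]%SET.

(** The Dyck condition: after [j] pushes at most [j] entries have been popped. Index 0 is the time
    before the first push, so the part there is 0. *)
Definition good_compositions (n : nat) : {set {ffun 'I_n.+1 -> 'I_n.+1}} :=
  [set x in compositions n | [forall j : 'I_n.+1, (psum (cyc x) j.+1 <= j)%N]]%SET.

Lemma good_compositionsP n (x : {ffun 'I_n.+1 -> 'I_n.+1}) :
  reflect (psum (cyc x) n.+1 = n /\
           forall j, (j <= n)%N -> (psum (cyc x) j.+1 <= j)%N)
    (x \in good_compositions n).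
Proof.
rewrite !inE; apply: (iffP andP) => -[/eqP e h]; split=> //; rewrite ?e //.
- by move=> j jn; have /forallP /(_ (Ordinal (jn : (j < n.+1)%N))) := h.
- by apply/forallP => j; apply: h; rewrite -ltnS.
Qed.

(** [overtakes] for sequences indexed by naturals, with [j = a + m] and the sum written as a
    difference of partial sums, kept free of subtraction. *)
Definition overtakesn (d : nat -> nat) (a b : nat) : Prop :=
  exists j : nat, [/\ (a < j)%N, (j <= b)%N & (psum d a + j <= psum d j + a)%N].

Lemma overE (d : nat -> nat) (e : int -> nat) (a b : nat) (i j : int) :
  i + b%:Z = j + a%:Z ->
  (forall k, (k < b - a)%N -> e (i + k%:Z) = d (a + k)%N) ->
  overtakes e i j <-> overtakesn d a b.
Proof.
move=> ij ed; split=> [[m [m0 mj md]]|[k [ak kb dk]]].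
  exists (a + m)%N; split; try lia.
  have -> : psum d (a + m) = (psum d a + \sum_(k < m) e (i + k%:Z)%R)%N.
    by rewrite psumD; congr addn; apply: eq_bigr => k _; rewrite ed//; move: (ltn_ord k); lia.
  by lia.
exists (k - a)%N; split; try lia.
have -> : (\sum_(l < k - a) e (i + l%:Z)%R = \sum_(l < k - a) d (a + l))%N.
  by apply: eq_bigr => l _; rewrite ed//; move: (ltn_ord l); lia.
by have := psumD d a (k - a); rewrite subnKC; [lia|exact: ltnW].
Qed.

(** Indices are shifted by one: [x] has a part before the first push, so the pops following the push
    of position [a] are counted at [a.+1]. *)
Definition codes (n : nat) (x : {ffun 'I_n.+1 -> 'I_n.+1}) (s : 'S_n) : Prop :=
  forall a b : 'I_n, (a < b)%N -> (s a < s b)%N <-> overtakesn (cyc x) a.+1 b.+1.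

Lemma card_ord_leq n (i k : nat) (A : {set 'I_n}) :
  (forall c, c \in A -> i <= c < i + k)%N -> (#|A| <= k)%N.
Proof.
move=> Ah; rewrite -(size_iota i k) cardE -(size_map val).
apply: uniq_leq_size; first by rewrite map_inj_uniq ?enum_uniq//; exact: val_inj.
by move=> z /mapP[c]; rewrite mem_enum => /Ah h ->; rewrite mem_iota.
Qed.

Section encode.
Variables (n : nat) (s : 'S_n).
Hypothesis s231 : s \in Av231 n.

(* The position just before which [a] leaves the stack, in the stack sorting of
   the 231-avoiding permutation [s]. *)
Let last_below (a : 'I_n) : nat := (\max_(j < n | (a <= j) && (s j <= s a)) j)%N.

Let last_below_ge (a : 'I_n) : (a <= last_below a)%N.
Proof. by apply: (@leq_bigmax_cond _ _ (fun j : 'I_n => j : nat)); rewrite !leqnn. Qed.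

Let last_below_attained (a : 'I_n) : exists2 c : 'I_n, last_below a = c & (a <= c)%N && (s c
  <= s a)%N.
Proof.
have [|c hc cE] := @eq_bigmax_cond _ [pred j : 'I_n | (a <= j) && (s j <= s a)]%N (fun j =>
  j : nat).
  by apply/card_gt0P; exists a; rewrite inE /= !leqnn.
by exists c.
Qed.

(** The only place where the pattern is used directly: a value above [s a] at a position between [a]
    and [last_below a] would be the 3 of a 231 whose 2 is at [a] and whose 1 is at
    [last_below a]. *)
Let last_belowE (a b : 'I_n) : (a <= b)%N -> (b <= last_below a)%N = (s b <= s a)%N.
Proof.
move=> ab; apply/idP/idP => h; last first.
  by apply: (@leq_bigmax_cond _ _ (fun j : 'I_n => j : nat)); rewrite ab h.
have [c cE /andP[ac sca]] := last_below_attained a.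
rewrite cE in h; rewrite leqNgt; apply/negP => sab.
have neq (u v : 'I_n) : (s u < s v)%N -> (u : nat) <> v.
  by move=> uv /val_inj e; rewrite e ltnn in uv.
have h1 := neq _ _ sab; have h2 := neq _ _ (leq_ltn_trans sca sab).
have h3 : s c <> s a by move=> /perm_inj e; rewrite e in h; lia.
have h4 : (s c : nat) <> s a by move=> /val_inj.
move: s231; rewrite inE => /negP; apply.
by apply/existsP; exists a; apply/existsP; exists b; apply/existsP; exists c;
  apply/and4P; split; lia.
Qed.

(** Stack discipline: an entry pushed above [a] leaves no later than [a]. *)
Let last_below_nested (a c : 'I_n) : (a <= c)%N -> (c <= last_below a)%N ->
  (last_below c <= last_below a)%N.
Proof.
move=> ac h; have [e -> /andP[ce sec]] := last_below_attained c.
rewrite last_belowE ?(leq_trans ac)// (leq_trans sec)//.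
by rewrite -last_belowE.
Qed.

(** Part [j] counts the entries popped right after [j] pushes. [inord] loses nothing, the count
    being at most [n]. *)
Let x : {ffun 'I_n.+1 -> 'I_n.+1} :=
  [ffun j : 'I_n.+1 => inord #|[set c : 'I_n | (last_below c).+1 == j]|%SET].

Let psumx j : (j <= n.+1)%N -> psum (cyc x) j = #|[set c : 'I_n | (last_below c).+1 <
  j]%N|%SET.
Proof.
elim: j => [_|j IH jn]; first by rewrite /psum big_ord0; apply/esym/eqP; rewrite cards_eq0;
  apply/eqP/setP => c; rewrite !inE.
rewrite psumS IH; last exact: ltnW.
rewrite /cyc ffunE inordK; last by rewrite ltnS -[leqRHS]card_ord max_card.
rewrite /= modn_small// -cardsUI.
rewrite [X in (_ + X)%N](_ : _ = 0)%N ?addn0; last first.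
  by apply/eqP; rewrite cards_eq0; apply/eqP/setP => c; rewrite !inE; lia.
by apply: eq_card => c; rewrite !inE; lia.
Qed.

Lemma exists_code : exists2 x, x \in good_compositions n & codes x s.
Proof.
have tot : psum (cyc x) n.+1 = n.
  rewrite psumx// (_ : [set _ | _]%SET = [set: 'I_n]%SET) ?cardsT ?card_ord//.
  apply/finset.setP => c; rewrite !inE ltnS; have [e -> _] := last_below_attained c.
  exact: ltn_ord.
exists x.
  apply/good_compositionsP; split=> // j jn; rewrite psumx//.
  by apply: (@card_ord_leq _ 0%N) => c; rewrite inE; have := last_below_ge c; lia.
move=> a b ab; rewrite /overtakesn.
have sE : (s a < s b)%N = (last_below a < b)%N.
  by rewrite !ltnNge last_belowE//; exact: ltnW.
rewrite sE; split=> [h|[j [aj jb]]].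
  (* This is the time just after [a] is popped. By then all entries of [I], from [a] to
     [last_below a], have been popped, and none of them before the push of [a], which gives the
     required number of pops. *)
  exists (last_below a).+2; split; [by have := last_below_ge a; lia|lia|].
  have ln : (last_below a < n)%N by apply: (ltn_trans h); exact: ltn_ord.
  rewrite !psumx//; last by have := last_below_ge a; lia.
  pose I := [set c : 'I_n | (a <= c)%N && (c <= last_below a)%N]%SET.
  have cI : #|I| = ((last_below a).+1 - a)%N.
    have -> : ((last_below a).+1 - a)%N = size (iota a ((last_below a).+1 - a)).
      by rewrite size_iota.
    rewrite cardE -(size_map val); apply/perm_size/uniq_perm.
    - by rewrite map_inj_uniq ?enum_uniq//; exact: val_inj.
    - exact: iota_uniq.
    - move=> z; rewrite mem_iota subnKC; last by have := last_below_ge a; lia.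
      rewrite ltnS; apply/mapP/idP => [[c]|za]; first by rewrite mem_enum inE => ? ->.
      have zn : (z < n)%N by lia.
      by exists (Ordinal zn) => //; rewrite mem_enum inE.
  have : (#|[set c : 'I_n | (last_below c).+1 < a.+1]%N%SET :|: I| <=
    #|[set c : 'I_n | (last_below c).+1 < (last_below a).+2]%N%SET|)%N.
    apply/subset_leq_card/fintype.subsetP => c; rewrite !inE => /orP[|/andP[h1 h2]].
      by have := last_below_ge a; lia.
    by have := last_below_nested h1 h2; lia.
  rewrite cardsU; have -> : ([set c : 'I_n | (last_below c).+1 < a.+1]%N%SET :&: I) =
    finset.set0.
    by apply/finset.setP => c; rewrite !inE; have := last_below_ge c; lia.
  by rewrite cards0 cI; have := last_below_ge a; lia.
have jn : (j <= n.+1)%N by have := ltn_ord b; lia.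
rewrite !psumx//; last by have := ltn_ord a; lia.
(* If [a] were still on the stack when [b] is pushed, the entries popped in the meantime would all
   lie strictly between [a] and [j - 1], hence be one too few. *)
move=> hj; rewrite ltnNge; apply/negP => hb.
have : (#|[set c : 'I_n | (last_below c).+1 < j]%N%SET :\:
    [set c : 'I_n | (last_below c).+1 < a.+1]%N%SET| <= j - a.+2)%N.
  apply: (@card_ord_leq _ a.+1) => c; rewrite !inE => h1.
  have cl := last_below_ge c.
  suff : (a < c)%N by lia.
  rewrite ltnNge; apply/negP => ca.
  have := @last_below_nested c a ca; lia.
rewrite cardsD (_ : _ :&: _ = [set c : 'I_n | (last_below c).+1 < a.+1]%N%SET); first by lia.
by apply/finset.setP => c; rewrite !inE; lia.
Qed.

End encode.

(** If [s a < s b], then [a] is popped before [b] is pushed, hence before [c] is pushed, and this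
    forces [s a < s c]. *)
Lemma codes_Av231 n (x : {ffun 'I_n.+1 -> 'I_n.+1}) (s : 'S_n) :
  codes x s -> s \in Av231 n.
Proof.
move=> xs; rewrite inE; apply/negP => /existsP[a /existsP[b /existsP[c /and4P[ab bc sca
  sab]]]].
have ac := ltn_trans ab bc.
have [j [aj jb h]] := iffLR (xs _ _ ab) sab.
suff : (s a < s c)%N by rewrite ltnNge (ltnW sca).
by apply/(xs _ _ ac); exists j; split=> //; lia.
Qed.

(** [walk_le] is a total order for any sequence, so the rank function of its restriction to the
    positions is a permutation with the prescribed comparisons. *)
Lemma exists_perm_codes n (x : {ffun 'I_n.+1 -> 'I_n.+1}) : exists s : 'S_n, codes x s.
Proof.
pose D (t : int) := cyc x (absz (t + 1)).
pose le (a b : 'I_n) := `[< walk_le D a%:Z b%:Z >].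
pose rank (a : 'I_n) := #|[set c : 'I_n | le c a & c != a]%SET|.
have rank_lt a : (rank a < n)%N.
  rewrite -[ltnRHS]card_ord -cardsT; apply/proper_card/properP; split.
    by apply/fintype.subsetP => c; rewrite !inE.
  by exists a; rewrite !inE ?eqxx ?andbF.
have rank_mono a b : le a b -> a != b -> (rank a < rank b)%N.
  move=> ab nab; apply/proper_card/properP; split.
    apply/fintype.subsetP => c; rewrite !inE => /andP[/asboolP ca nca].
    have := walk_le_trans ca (asboolW ab) => cb; apply/andP; split; first exact/asboolP.
    apply: contra nca => /eqP cE; rewrite cE in ca *; apply/eqP/val_inj.
    by have := walk_le_anti ca (asboolW ab) => -[].
  by exists a; rewrite !inE ?ab ?nab// eqxx andbF.
have le_total (a b : 'I_n) : le a b \/ le b a.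
  by case: (walk_le_total D a b) => h; [left|right]; exact/asboolP.
pose f a := Ordinal (rank_lt a).
have f_inj : injective f.
  move=> a b [] e; apply/eqP; apply: contraPT (e) => nab.
  have [h|h] := le_total a b; first by have := rank_mono _ _ h nab; lia.
  by rewrite eq_sym in nab; have := rank_mono _ _ h nab; lia.
exists (perm f_inj) => a b ab; rewrite !permE.
have nab : a != b by apply: contraTneq ab => ->; rewrite ltnn.
have -> : (f a < f b)%N <-> le a b.
  split=> [h|h]; last exact: rank_mono.
  have [//|ba] := le_total a b.
  by rewrite eq_sym in nab; have := rank_mono _ _ ba nab; move: h => /=; lia.
rewrite -(@overE (cyc x) D a.+1 b.+1 a b).
- split=> [/asboolP[e|[]//|[]]|h]; try lia.
  by apply/asboolP; constructor 2; split.
- by lia.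
- by move=> k _; rewrite /D; congr (cyc x _); lia.
Qed.

(** The code fixes all comparisons between values, and [s a] is the number of values below it. *)
Lemma codes_inj_perm n (x : {ffun 'I_n.+1 -> 'I_n.+1}) (s s' : 'S_n) :
  codes x s -> codes x s' -> s = s'.
Proof.
move=> xs xs'.
have sE (t : 'S_n) a : (t a : nat) = #|[set b | t b < t a]%N%SET|.
  have -> : [set b | t b < t a]%N%SET = t @^-1: [set c : 'I_n | c < t a]%N%SET.
    by apply/finset.setP => b; rewrite !inE.
  rewrite card_preimset; last exact: perm_inj.
  rewrite cardE -(size_map val) -{1}(size_iota 0 (t a)); apply/perm_size/uniq_perm.
  - exact: iota_uniq.
  - by rewrite map_inj_uniq ?enum_uniq//; exact: val_inj.
  - move=> z; rewrite mem_iota add0n leq0n /=; apply/idP/mapP => [za|[c]].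
      by exists (Ordinal (ltn_trans za (ltn_ord _))); rewrite ?mem_enum ?inE.
    by rewrite mem_enum inE => ? ->.
have lt_iff a b : (s a < s b)%N = (s' a < s' b)%N.
  case: (ltngtP a b) => ab.
  - by apply/idP/idP => h; [apply/(xs' _ _ ab)/(xs _ _ ab)|apply/(xs _ _ ab)/(xs' _ _ ab)].
  - have F (t : 'S_n) : (t a < t b)%N = ~~ (t b < t a)%N.
      rewrite -leqNgt [RHS]leq_eqVlt; suff -> : (t a == t b :> nat) = false by [].
      by apply/negbTE/eqP => /val_inj/perm_inj e; rewrite e ltnn in ab.
    rewrite !F; congr (~~ _).
    by apply/idP/idP => h; [apply/(xs' _ _ ab)/(xs _ _ ab)|apply/(xs _ _ ab)/(xs' _ _ ab)].
  - by have -> : a = b; [exact/val_inj|rewrite !ltnn].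
apply/permP => a; apply/val_inj => /=; rewrite (sE s) (sE s'); apply: eq_card => b.
by rewrite !inE lt_iff.
Qed.

(** At the first index [j] where the codes differ, say [x'] pops more. The last entry popped there
    by [x'] is gone when position [j] is pushed, whereas under [x] it is still on the stack, so the
    two codes order these positions differently. *)
Lemma codes_inj n (x x' : {ffun 'I_n.+1 -> 'I_n.+1}) (s : 'S_n) :
  x \in good_compositions n -> x' \in good_compositions n ->
  codes x s -> codes x' s -> x = x'.
Proof.
move=> gx gx' xs xs'; apply: contrapT => nxx'.
have ex : exists j : nat, (j <= n)%N && (cyc x j != cyc x' j).
  apply: contrapT => nex; apply: nxx'; apply/ffunP => i; apply/val_inj/eqP.
  apply: contrapT => /negP ne; apply: nex; exists i.
  by rewrite -ltnS ltn_ord /cyc valZpK.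
case: (ex_minnP ex) => j /andP[jn nj] jmin.
wlog : x x' gx gx' xs xs' nxx' ex nj jmin / (cyc x j < cyc x' j)%N.
  move=> wl; case: (ltngtP (cyc x j) (cyc x' j)) nj => // lt _.
    by apply: (wl x x') => //; rewrite neq_ltn lt.
  apply: (wl x' x) => //; first by move=> /esym.
  - by case: ex => i; rewrite eq_sym; exists i.
  - by rewrite neq_ltn lt.
  - by move=> i; rewrite eq_sym; exact: jmin.
move=> lt {nj}.
have /good_compositionsP[tx px] := gx; have /good_compositionsP[tx' px'] := gx'.
have pre i : (i <= j)%N -> psum (cyc x) i = psum (cyc x') i.
  move=> ij; apply: eq_bigr => k _; apply/eqP; apply: contrapT => /negP ne.
  by have := jmin k; rewrite ne andbT; have := ltn_ord k; lia.
have pj : (psum (cyc x) j.+1 < psum (cyc x') j.+1)%N.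
  by rewrite !psumS (pre j)//; lia.
have jn' : (j < n)%N.
  by rewrite ltn_neqAle jn andbT; apply/eqP => e; rewrite e tx tx' ltnn in pj.
have j0 : (0 < j)%N.
  by case: (posnP j) => // e; have := px' 0%N isT; rewrite e in pj; lia.
(* The largest such [i] is the number, counted from 1, of the last entry popped by [x'] at index
   [j]. The value 1 is admissible because [x] and [x'] are good. *)
have ex1 : exists i : nat, [&& 0 < i, i <= j & j.+1 + psum (cyc x) i >= i + psum (cyc x')
  j.+1]%N.
  by exists 1%N; have := px 0%N isT; have := px' j jn; lia.
have ub i : [&& 0 < i, i <= j & j.+1 + psum (cyc x) i >= i + psum (cyc x') j.+1]%N -> (i <=
  j)%N.
  by case/and3P.
case: (ex_maxnP ex1 ub) => al /and3P[al0 alj hal] almax.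
have an : (al.-1 < n)%N by lia.
pose a := Ordinal an; pose b := Ordinal jn'.
have ab : (a < b)%N by rewrite /=; lia.
have aE : (a.+1 = al)%N by rewrite /= prednK.
have : (s a < s b)%N.
  apply/(xs' _ _ ab); exists j.+1; rewrite aE /=; split; try lia.
  have := pre al alj; have := psumS (cyc x) al.
  have [e|alj'] : (al = j \/ al < j)%N by lia.
    by move: pj; rewrite e; lia.
  by have := almax al.+1; lia.
move=> /(iffLR (xs _ _ ab))[i []]; rewrite aE /= => ali ij h.
have [e|i_le] : (i = j.+1 \/ i <= j)%N by lia.
  by move: h; rewrite e; lia.
have : (j.+1 + psum (cyc x) i < i + psum (cyc x') j.+1)%N.
  by rewrite ltnNge; apply/negP => hi; have := almax i; lia.
lia.
Qed.

(** Choosing a coded permutation is injective on good compositions, by [codes_inj]. *)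
Lemma card_good_compositions n : (#|good_compositions n| <= #|Av231 n|)%N.
Proof.
have [f fP] := choice (@exists_perm_codes n).
rewrite -(@card_in_imset _ _ f); last first.
  by move=> x y gx gy /= e; apply: (codes_inj gx gy (fP x)); rewrite e.
apply/subset_leq_card/fintype.subsetP => s /imsetP[x _ ->]; exact: codes_Av231 (fP x).
Qed.

(** The converse count, relative to events: choosing a good code is injective, since a code
    determines its permutation. *)
Lemma card_Av231_codes n (P : {set 'S_n}) (Q : {set {ffun 'I_n.+1 -> 'I_n.+1}}) :
  (forall s x, s \in P -> x \in good_compositions n -> codes x s -> x \in Q) ->
  (#|Av231 n :&: P| <= #|good_compositions n :&: Q|)%N.
Proof.
move=> PQ.
have [f fP] : {f : 'S_n -> {ffun 'I_n.+1 -> 'I_n.+1} &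
    forall s, s \in Av231 n -> f s \in good_compositions n /\ codes (f s) s}.
  apply: (@choice _ _ (fun s x => s \in Av231 n -> x \in good_compositions n /\ codes x s))
    => s.
  have [sA|sA] := boolP (s \in Av231 n); last by exists [ffun=> ord0].
  by have [x ? ?] := exists_code sA; exists x.
rewrite -(@card_in_imset _ _ f); last first.
  move=> s t; rewrite !finset.in_setI => /andP[sA _] /andP[tA _] e.
  have [_ fs] := fP s sA; have [_ ft] := fP t tA.
  by rewrite e in fs; exact: codes_inj_perm fs ft.
apply/subset_leq_card/fintype.subsetP => x /imsetP[s];
  rewrite finset.in_setI => /andP[sA sP] ->.
by have [g c] := fP s sA; rewrite finset.in_setI g (PQ s).
Qed.

(** * The cycle lemma *)

Definition rotate n (u : 'I_n.+1) (x : {ffun 'I_n.+1 -> 'I_n.+1}) :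
    {ffun 'I_n.+1 -> 'I_n.+1} := [ffun i => x (u + i)].

Lemma rotate0 n (x : {ffun 'I_n.+1 -> 'I_n.+1}) : rotate 0 x = x.
Proof. by apply/ffunP => i; rewrite ffunE add0r. Qed.

Lemma rotateD n (u v : 'I_n.+1) (x : {ffun 'I_n.+1 -> 'I_n.+1}) :
  rotate u (rotate v x) = rotate (v + u) x.
Proof. by apply/ffunP => i; rewrite !ffunE addrA. Qed.

Lemma rotate_inj n (u : 'I_n.+1) : injective (rotate u).
Proof. by apply: (can_inj (g := rotate (- u))) => x; rewrite rotateD subrr rotate0. Qed.

Lemma cyc_rotate n (u : 'I_n.+1) x j : cyc (rotate u x) j = cyc x (u + j).
Proof.
by rewrite /cyc ffunE; congr (x _ : nat); apply/val_inj; rewrite /= modnDmr.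
Qed.

Lemma cyc_period n (x : {ffun 'I_n.+1 -> 'I_n.+1}) j : cyc x (j + n.+1) = cyc x j.
Proof. by rewrite /cyc; congr (x _ : nat); apply/val_inj; rewrite /= modnDr. Qed.

Lemma psum_cyc_full n (x : {ffun 'I_n.+1 -> 'I_n.+1}) :
  psum (cyc x) n.+1 = (\sum_i (x i : nat))%N.
Proof. by apply: eq_bigr => i _; rewrite /cyc valZpK. Qed.

Lemma compositions_rotate n (u : 'I_n.+1) x :
  (rotate u x \in compositions n) = (x \in compositions n).
Proof.
rewrite !inE !psum_cyc_full [in RHS](reindex_inj (addrI u)) /=.
by congr (_ == _); apply: eq_bigr => i _; rewrite ffunE.
Qed.

Lemma psum_rotate n (u : 'I_n.+1) x j :
  (psum (cyc x) (u + j) = psum (cyc x) u + psum (cyc (rotate u x)) j)%N.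
Proof. by rewrite psumD; congr addn; apply: eq_bigr => k _; rewrite cyc_rotate. Qed.

Lemma psum_period n (x : {ffun 'I_n.+1 -> 'I_n.+1}) j :
  x \in compositions n -> psum (cyc x) (j + n.+1) = (psum (cyc x) j + n)%N.
Proof.
rewrite inE => /eqP xn; rewrite addnC psumD xn addnC; congr addn.
by apply: eq_bigr => k _; rewrite addnC cyc_period.
Qed.

(* The good rotation starts right after the last minimum of [i - psum i]. *)
Lemma exists_good_rotation n (x : {ffun 'I_n.+1 -> 'I_n.+1}) :
  x \in compositions n -> exists u, rotate u x \in good_compositions n.
Proof.
move=> xn; pose Q i : int := i%:Z - (psum (cyc x) i)%:Z.
have [m mP] : exists m : 'I_n.+1, forall i : 'I_n.+1, Q m <= Q i.
  by exists [arg min_(i < ord0) Q i]%O => i; case: arg_minP => // k _; exact.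
have ex : exists i : nat, (i < n.+1)%N && (Q i == Q m) by exists m; rewrite ltn_ord eqxx.
have ub i : (i < n.+1)%N && (Q i == Q m) -> (i <= n)%N by case/andP.
case: (ex_maxnP ex ub) => u /andP[un /eqP uQ] umax.
have hQ j : (u < j)%N -> (j <= u + n.+1)%N -> Q u < Q j.
  move=> uj jn; have [jn'|jn'] := ltnP j n.+1.
    rewrite uQ lt_neqAle (mP (Ordinal jn')) andbT; apply/eqP => e.
    by have := umax j; rewrite jn' e eqxx; lia.
  have k_lt : (j - n.+1 < n.+1)%N by lia.
  have := mP (Ordinal k_lt); rewrite -uQ /Q /= => hk.
  by have := psum_period (j - n.+1) xn; rewrite subnK//; lia.
exists (Ordinal un); apply/good_compositionsP; split.
  by apply/eqP; have := compositions_rotate (Ordinal un) x; rewrite xn inE.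
move=> j jn; have := hQ (u + j.+1)%N; have := psum_rotate (Ordinal un) x j.+1.
rewrite /Q /=; lia.
Qed.

(** Cut the cycle at two distinct good starting points: each of the two arcs has a sum smaller than
    its length, so the total is at most [n - 1] instead of [n]. *)
Lemma good_rotation_uniq n (x : {ffun 'I_n.+1 -> 'I_n.+1}) u v :
  rotate u x \in good_compositions n -> rotate v x \in good_compositions n -> u = v.
Proof.
wlog : u v / (u <= v)%N.
  move=> wl gu gv; case: (leqP u v) => uv; first exact: wl.
  by apply/esym; apply: wl => //; exact: ltnW.
move=> uv gu gv; apply/eqP; apply: contrapT => /negP nuv.
have uv' : (u < v)%N by rewrite ltn_neqAle uv andbT.
have xn : x \in compositions n.
  by rewrite -(compositions_rotate u); move: gu; rewrite inE => /andP[].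
have /good_compositionsP[_ pu] := gu; have /good_compositionsP[_ pv] := gv.
have := ltn_ord v => vn.
have := pu (v - u).-1; rewrite prednK; last by lia.
have := pv (n - (v - u))%N.
have := psum_rotate u x (v - u); rewrite subnKC//.
have := psum_rotate v x (n - (v - u)).+1.
have -> : (v + (n - (v - u)).+1 = u + n.+1)%N by lia.
rewrite (psum_period u xn); lia.
Qed.

(** A pair of a good composition and a rotation can be recovered from the rotated composition, by
    uniqueness of the good rotation. *)
Lemma card_compositions_good n (Q : {set {ffun 'I_n.+1 -> 'I_n.+1}}) :
  (forall u x, x \in Q -> rotate u x \in Q) ->
  (#|good_compositions n :&: Q| * n.+1 <= #|compositions n :&: Q|)%N.
Proof.
move=> Qrot; have -> : (#|good_compositions n :&: Q| * n.+1 =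
    #|finset.setX (good_compositions n :&: Q) [set: 'I_n.+1]%SET|)%N.
  by rewrite cardsX cardsT card_ord.
pose f (p : {ffun 'I_n.+1 -> 'I_n.+1} * 'I_n.+1) := rotate p.2 p.1.
rewrite -(@card_in_imset _ _ f).
  apply/subset_leq_card/fintype.subsetP => y /imsetP[[x u]].
  rewrite finset.in_setX finset.in_setI => /andP[/andP[gx xQ] _] ->.
  rewrite finset.in_setI compositions_rotate Qrot// andbT.
  by move: gx; rewrite inE => /andP[].
move=> [x u] [y v]; rewrite !finset.in_setX !finset.in_setI.
move=> /andP[/andP[gx _] _] /andP[/andP[gy _] _]; rewrite /f /= => e.
have gx' : rotate (- u) (rotate u x) \in good_compositions n.
  by rewrite rotateD subrr rotate0.
have gy' : rotate (- v) (rotate u x) \in good_compositions n.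
  by rewrite e rotateD subrr rotate0.
have uv : u = v by apply: oppr_inj; exact: good_rotation_uniq gx' gy'.
by rewrite uv in e *; rewrite (rotate_inj e).
Qed.

(** Every composition is a rotation of a good one, so the same map is onto. *)
Lemma card_compositions_le n : (#|compositions n| <= #|good_compositions n| * n.+1)%N.
Proof.
have -> : (#|good_compositions n| * n.+1 =
    #|finset.setX (good_compositions n) [set: 'I_n.+1]%SET|)%N.
  by rewrite cardsX cardsT card_ord.
pose f (p : {ffun 'I_n.+1 -> 'I_n.+1} * 'I_n.+1) := rotate p.2 p.1.
apply: (leq_trans _ (leq_imset_card f _)).
apply/subset_leq_card/fintype.subsetP => x /exists_good_rotation[u gu].
apply/imsetP; exists (rotate u x, - u); first by rewrite finset.in_setX gu finset.in_setT.
by rewrite /f /= rotateD subrr rotate0.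
Qed.

(** The transfer principle, with denominators cleared: the proportion of [P] among 231-avoiding
    permutations is at most the proportion of the rotation invariant event [Q] among
    compositions. *)
Lemma card_Av231_compositions n (P : {set 'S_n}) (Q : {set {ffun 'I_n.+1 -> 'I_n.+1}}) :
  (forall u x, x \in Q -> rotate u x \in Q) ->
  (forall s x, s \in P -> x \in good_compositions n -> codes x s -> x \in Q) ->
  (#|Av231 n :&: P| * #|compositions n| <= #|compositions n :&: Q| * #|Av231 n|)%N.
Proof.
move=> Qrot PQ.
apply: (leq_trans (leq_mul (card_Av231_codes PQ) (card_compositions_le n))).
rewrite mulnCA mulnC -mulnA [X in (_ <= X)%N]mulnC mulnC.
have := card_compositions_good Qrot; have := card_good_compositions n.
move: #|_| #|_ :&: _| #|_| #|_ :&: _| => a b c e h1 h2.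
nia.
Qed.

(** * Counting compositions *)

(** Subtracting [c] leaves the compositions of [n - s] into [n + 1] parts, with zero parts allowed,
    which are counted by stars and bars. *)
Lemma card_compositions_ge n (c : 'I_n.+1 -> nat) : (\sum_i c i <= n)%N ->
  #|[set x in compositions n | [forall i, (c i <= x i)%N]]%SET| =
  'C(n.*2 - \sum_i c i, n).
Proof.
set s := (\sum_i c i)%N => sn.
have -> : (n.*2 - s)%N = (n + (n - s))%N by lia.
rewrite -card_ord_partitions.
set T := [set t : n.+1.-tuple 'I_(n - s).+1 | _]%SET.
pose g (t : n.+1.-tuple 'I_(n - s).+1) : {ffun 'I_n.+1 -> 'I_n.+1} :=
  [ffun i => inord (tnth t i + c i)].
have cs i : (c i <= s)%N by rewrite /s (bigD1 i)//= leq_addr.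
have gE t i : g t i = (tnth t i + c i)%N :> nat.
  by rewrite ffunE inordK//; have := ltn_ord (tnth t i); have := cs i; lia.
have g_inj : injective g.
  move=> t t' e; apply/eq_from_tnth => i; apply/val_inj.
  by apply: (@addIn (c i)); rewrite -[LHS]gE -[RHS]gE e.
rewrite -(card_imset _ g_inj); apply: eq_card => x.
rewrite inE; apply/andP/imsetP => [[xn /forallP cx]|[t]].
  move: xn; rewrite inE psum_cyc_full => /eqP xn.
  have sub : (\sum_i (x i - c i) = n - s)%N.
    by rewrite sumnB//; first by rewrite xn.
  exists [tuple inord (x i - c i) | i < n.+1].
    rewrite inE big_tuple -[X in _ == X]sub; apply/eqP; apply: eq_bigr => i _.
    rewrite tnth_mktuple inordK// ltnS -sub.
    by rewrite (bigD1 i)//= leq_addr.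
  apply/ffunP => i; apply/val_inj => /=; rewrite gE tnth_mktuple inordK.
    by rewrite subnK.
  by rewrite ltnS -sub (bigD1 i)//= leq_addr.
rewrite inE big_tuple => /eqP ts ->; split.
  rewrite inE psum_cyc_full; rewrite (eq_bigr (fun i => tnth t i + c i)%N) => [|i _];
    last exact: gE.
  by rewrite big_split /= ts subnK.
by apply/forallP => i; rewrite gE leq_addl.
Qed.

Lemma card_compositions n : #|compositions n| = 'C(n.*2, n).
Proof.
have := @card_compositions_ge n (fun=> 0%N); rewrite big1// subn0 => <-//.
apply: eq_card => x; rewrite [RHS]inE.
by rewrite (_ : [forall i, _])// ?andbT//; apply/forallP.
Qed.

(** * Second moments of cyclic averages *)

Section averages.
Variable R : realType.
Implicit Types (F G : (nat -> nat) -> R) (l : R) (n : nat).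

Definition cmean n (f : {ffun 'I_n.+1 -> 'I_n.+1} -> R) : R :=
  #|compositions n|%:R^-1 * \sum_(x in compositions n) f x.

Lemma compositions_gt0 n : 0 < #|compositions n|%:R :> R.
Proof. by rewrite card_compositions ltr0n bin_gt0; lia. Qed.

Lemma cmeanD n (f g : {ffun 'I_n.+1 -> 'I_n.+1} -> R) :
  cmean (fun x => f x + g x) = cmean f + cmean g.
Proof. by rewrite /cmean big_split mulrDr. Qed.

Lemma cmeanZ n a (f : {ffun 'I_n.+1 -> 'I_n.+1} -> R) :
  cmean (fun x => a * f x) = a * cmean f.
Proof. by rewrite /cmean -mulr_sumr mulrCA. Qed.

Lemma cmean_cst n a : cmean (fun _ : {ffun 'I_n.+1 -> 'I_n.+1} => a) = a.
Proof.
rewrite /cmean sumr_const -(mulr_natl a) mulrA mulVf ?mul1r//.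
by rewrite gt_eqF// compositions_gt0.
Qed.

Lemma cmean_sum n (I : finType) (f : I -> {ffun 'I_n.+1 -> 'I_n.+1} -> R) :
  cmean (fun x => \sum_i f i x) = \sum_i cmean (f i).
Proof. by rewrite /cmean exchange_big mulr_sumr. Qed.

Lemma le_cmean n (f g : {ffun 'I_n.+1 -> 'I_n.+1} -> R) :
  (forall x, f x <= g x) -> cmean f <= cmean g.
Proof.
move=> fg; rewrite /cmean ler_pM2l ?invr_gt0 ?compositions_gt0//.
by apply: ler_sum => x _.
Qed.

Lemma cmean_rotate n (u : 'I_n.+1) (f : {ffun 'I_n.+1 -> 'I_n.+1} -> R) :
  cmean (fun x => f (rotate u x)) = cmean f.
Proof.
rewrite /cmean; congr (_ * _); rewrite [RHS](reindex_inj (@rotate_inj n u)) /=.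
by apply: eq_bigl => x; rewrite compositions_rotate.
Qed.

Definition cavg F n (x : {ffun 'I_n.+1 -> 'I_n.+1}) : R :=
  n.+1%:R^-1 * \sum_u F (cyc (rotate u x)).

(** Convergence in L2, under uniform compositions, of the averages of [F] along the cycle to the
    constant [l]. *)
Definition cvg_avg F l : Prop :=
  cmean (fun x : {ffun 'I_n.+1 -> 'I_n.+1} => (cavg F x - l) ^+ 2) @[n --> \oo] --> (0 : R).

Lemma cvg_avgZ a F l : cvg_avg F l -> cvg_avg (fun w => a * F w) (a * l).
Proof.
move=> Fl; rewrite /cvg_avg.
have -> : (fun n => cmean (fun x : {ffun 'I_n.+1 -> 'I_n.+1} =>
    (cavg (fun w => a * F w) x - a * l) ^+ 2)) =
    (fun n => a ^+ 2 * cmean (fun x : {ffun 'I_n.+1 -> 'I_n.+1} => (cavg F x - l) ^+ 2)).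
  apply/funext => n; rewrite -cmeanZ; congr cmean; apply/funext => x.
  by rewrite /cavg -mulr_sumr mulrCA -mulrBr exprMn.
by rewrite -(mulr0 (a ^+ 2)); apply: cvgMr.
Qed.

Lemma cvg_avgD F G l k : cvg_avg F l -> cvg_avg G k ->
  cvg_avg (fun w => F w + G w) (l + k).
Proof.
move=> Fl Gk; rewrite /cvg_avg.
pose m2 H (p : R) n := cmean (fun x : {ffun 'I_n.+1 -> 'I_n.+1} => (cavg H x - p) ^+ 2).
apply: (@squeeze_cvgr _ _ _ _ (fun=> 0) (fun n => 2 * m2 F l n + 2 * m2 G k n)).
- apply: nearW => n; apply/andP; split.
    by rewrite -(cmean_cst n 0); apply: le_cmean => x; exact: sqr_ge0.
  rewrite /m2 -!cmeanZ -cmeanD; apply: le_cmean => x.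
  have -> : cavg (fun w => F w + G w) x = cavg F x + cavg G x.
    by rewrite /cavg big_split mulrDr.
  move: (cavg F x) (cavg G x) => p q; have := sqr_ge0 ((p - l) - (q - k)); nra.
- exact: cvg_cst.
- rewrite -(addr0 0) -{1}(mulr0 2) -{2}(mulr0 2).
  by apply: cvgD; apply: cvgMr.
Qed.

Definition threshold (m : nat) (c : nat -> nat) (w : nat -> nat) : R :=
  [forall k : 'I_m, (c k <= w k)%N]%:R.

(** Passing from [s] to [s + 1] multiplies the binomial coefficient by [(n - s) / (2 n - s)], which
    tends to 1/2. *)
Lemma cvg_bin (s : nat) :
  ('C(n.*2 - s, n)%:R / 'C(n.*2, n)%:R : R) @[n --> \oo] --> (2 ^- s : R).
Proof.
elim: s => [|s IH].
  rewrite expr0 invr1; apply: cvg_near_cst; apply: nearW => n.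
  by rewrite subn0 divff// pnatr_eq0 -lt0n bin_gt0; lia.
have inv0 : (n%:R^-1 : R) @[n --> \oo] --> (0 : R).
  by rewrite -cvg_shiftS; exact: cvg_harmonic.
have half : ((1 - s%:R * n%:R^-1) * (2 - s%:R * n%:R^-1)^-1 : R) @[n --> \oo] --> (2^-1 : R).
  have h (a : R) : (a - s%:R * n%:R^-1) @[n --> \oo] --> a.
    rewrite -[X in _ --> X]subr0 -(mulr0 s%:R); apply: cvgB; first exact: cvg_cst.
    exact: cvgMr.
  by rewrite -[X in _ --> X]mul1r; apply: cvgM; [exact: h|apply: (cvgV _ (h 2));
    rewrite pnatr_eq0].
rewrite exprS invfM mulrC.
apply: cvg_trans (cvgM IH half); apply: near_eq_cvg.
near=> n.
have sn : (s < n)%N by near: n; exact: nbhs_infty_gt.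
have := mul_bin_down (n.*2 - s) n.
have -> : (n.*2 - s).-1 = (n.*2 - s.+1)%N by lia.
have -> : (n.*2 - s - n = n - s)%N by lia.
move=> /(congr1 (fun k : nat => k%:R : R)); rewrite !natrM => e.
have nE : (n.*2 - s)%:R = n%:R * (2 - s%:R * n%:R^-1) :> R.
  rewrite natrB; last by lia.
  rewrite mulrBr mulrCA divff ?mulr1 ?pnatr_eq0; last by lia.
  by rewrite -muln2 natrM.
have n0 : n%:R != 0 :> R by rewrite pnatr_eq0; lia.
have nE' : (n - s)%:R = n%:R * (1 - s%:R * n%:R^-1) :> R.
  by rewrite natrB; [field|lia].
have d0 : 2 - s%:R * n%:R^-1 != 0 :> R.
  have : (n.*2 - s)%:R != 0 :> R by rewrite pnatr_eq0; lia.
  by rewrite nE mulf_eq0 negb_or => /andP[].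
have b0 : 'C(n.*2, n)%:R != 0 :> R by rewrite pnatr_eq0 -lt0n bin_gt0; lia.
have {e} e : 'C(n.*2 - s.+1, n)%:R = (1 - s%:R * n%:R^-1) / (2 - s%:R * n%:R^-1) * 'C(n.*2 -
  s, n)%:R :> R.
  apply: (mulfI n0); apply: (mulfI d0).
  rewrite mulrA [X in X * _ = _]mulrC -nE e nE'.
  rewrite !mulrA [_ * n%:R]mulrC -!mulrA; congr (_ * _); rewrite !mulrA.
  by rewrite [_ * (1 - _)]mulrC mulfK.
by rewrite /= e; ring.
Unshelve. all: by end_near. Qed.

End averages.

Section threshold_averages.
Variable R : realType.

Lemma cmean_ge n (c : 'I_n.+1 -> nat) : (\sum_i c i <= n)%N ->
  cmean (fun x : {ffun 'I_n.+1 -> 'I_n.+1} => [forall i, (c i <= x i)%N]%:R : R) =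
  'C(n.*2 - \sum_i c i, n)%:R / 'C(n.*2, n)%:R.
Proof.
move=> cn; rewrite /cmean mulrC -card_compositions_ge// card_compositions.
congr (_ / _); rewrite -natr_sum; congr _%:R.
by rewrite -sum1_card big_mkcond [RHS]big_mkcond; apply: eq_bigr => x _; rewrite !inE;
  case: ifP => //=; case: ifP.
Qed.

Lemma sum_window n m (c : nat -> nat) : (m <= n.+1)%N ->
  (\sum_(i < n.+1) (if (i < m)%N then c i else 0) = psum c m)%N.
Proof. by move=> mn; rewrite -big_mkcond /= -big_ord_widen. Qed.

(** Padding [c] with zeros turns a condition on a window into one on all coordinates, the form
    required by [cmean_ge]. *)
Lemma threshold_cyc n m (c : nat -> nat) (x : {ffun 'I_n.+1 -> 'I_n.+1}) :
  (m <= n.+1)%N -> threshold R m c (cyc x) =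
  [forall i : 'I_n.+1, ((if (i < m)%N then c i else 0) <= x i)%N]%:R.
Proof.
move=> mn; congr (nat_of_bool _)%:R; apply/forallP/forallP => h.
  move=> i; case: ifP => // im; have := h (Ordinal im).
  by rewrite /cyc /= valZpK.
move=> k; have kn : (k < n.+1)%N by exact: leq_trans mn.
have := h (Ordinal kn); rewrite /= ltn_ord /cyc.
by rewrite (_ : inZp k = Ordinal kn)//; apply/val_inj; rewrite /= modn_small.
Qed.

Lemma threshold_cyc_rotate n m (c : nat -> nat) v (x : {ffun 'I_n.+1 -> 'I_n.+1}) :
  (m <= n.+1)%N -> threshold R m c (cyc (rotate v x)) =
  [forall i : 'I_n.+1, ((if ((i - v)%R < m)%N then c (i - v)%R else 0) <= x i)%N]%:R.
Proof.
move=> mn; rewrite threshold_cyc//; congr (nat_of_bool _)%:R.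
apply/forallP/forallP => h i.
  by have := h (i - v); rewrite ffunE [v + _]addrC subrK.
by have := h (v + i); rewrite ffunE [v + i]addrC addrK.
Qed.

(** The hypotheses on [v] make the two windows disjoint on the cycle, so at each coordinate at most
    one of the two bounds is nonzero and their sum imposes both. *)
Lemma threshold_cycM n m (c : nat -> nat) (v : 'I_n.+1) (x : {ffun 'I_n.+1 -> 'I_n.+1}) :
  (m <= v)%N -> (v + m <= n.+1)%N ->
  threshold R m c (cyc x) * threshold R m c (cyc (rotate v x)) =
  [forall i : 'I_n.+1, ((if (i < m)%N then c i else 0) +
              (if ((i - v)%R < m)%N then c (i - v)%R else 0) <= x i)%N]%:R.
Proof.
move=> mv vm; have mn : (m <= n.+1)%N by lia.
rewrite threshold_cyc// threshold_cyc_rotate// -natrM mulnb.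
congr (nat_of_bool _)%:R; apply/andP/forallP => [[/forallP h1 /forallP h2] i|h].
  have := h1 i; have := h2 i; case: (ltnP i m) => // im.
  have -> : ((i - v)%R < m)%N = false; last by rewrite addn0.
  apply/negbTE; rewrite -leqNgt /= (@modn_small (n.+1 - v)); last by lia.
  by rewrite modn_small; lia.
by split; apply/forallP => i; apply: leq_trans (h i); rewrite ?leq_addr ?leq_addl.
Qed.

Lemma threshold_ge0 m c w : 0 <= threshold R m c w.
Proof. exact: ler0n. Qed.

Lemma threshold_le1 m c w : threshold R m c w <= 1.
Proof. by rewrite lern1 leq_b1. Qed.

(** By rotation invariance, the first window of each pair can be moved to the origin. *)
Lemma cmean_cavg_sqr n (F : (nat -> nat) -> R) :
  cmean (fun x : {ffun 'I_n.+1 -> 'I_n.+1} => cavg F x ^+ 2) =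
  n.+1%:R^-1 * \sum_v cmean (fun x : {ffun 'I_n.+1 -> 'I_n.+1} => F (cyc x) * F (cyc (rotate
    v x))).
Proof.
have -> : (fun x : {ffun 'I_n.+1 -> 'I_n.+1} => cavg F x ^+ 2) = (fun x =>
    n.+1%:R^-1 ^+ 2 * \sum_(u < n.+1) \sum_(v < n.+1)
      F (cyc (rotate u x)) * F (cyc (rotate v (rotate u x)))).
  apply/funext => x; rewrite /cavg exprMn; congr (_ * _).
  rewrite expr2 mulr_suml; apply: eq_bigr => u _; rewrite mulr_sumr.
  rewrite [LHS](reindex_inj (addrI u)) /=; apply: eq_bigr => v _.
  by rewrite rotateD.
rewrite cmeanZ cmean_sum.
rewrite (eq_bigr (fun=> \sum_v cmean (fun x : {ffun 'I_n.+1 -> 'I_n.+1} => F (cyc x) * F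
  (cyc (rotate v x))))); last first.
  move=> u _; rewrite -cmean_sum.
  exact: (cmean_rotate u (fun x : {ffun 'I_n.+1 -> 'I_n.+1} => \sum_v F (cyc x) * F (cyc
    (rotate v x)))).
by rewrite sumr_const card_ord -(mulr_natl (\sum_v _)) expr2 -mulrA mulKf.
Qed.

(** Expand the square. The mean of the average is [p s n], which tends to [l]; its second moment is
    at most [p s.*2 n] plus the share of overlapping pairs of windows, which tends to [l ^+ 2]. *)
Lemma cvg_avg_threshold m c : cvg_avg (threshold R m c) (2 ^- psum c m).
Proof.
rewrite /cvg_avg; set s := psum c m; set l : R := 2 ^- s.
pose p k n : R := 'C(n.*2 - k, n)%:R / 'C(n.*2, n)%:R.
apply: (@squeeze_cvgr _ _ _ _ (fun=> 0)
  (fun n => p s.*2 n + m.*2%:R * n.+1%:R^-1 - (2 * l) * p s n + l ^+ 2)).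
- near=> n.
  have mn : (m.*2 <= n)%N by near: n; exact: nbhs_infty_ge.
  have sn : (s.*2 <= n)%N by near: n; exact: nbhs_infty_ge.
  have mn1 : (m <= n.+1)%N by lia.
  have sumE : (\sum_(i < n.+1) (if (i < m)%N then c i else 0) = s)%N by exact: sum_window.
  apply/andP; split.
    by rewrite -(cmean_cst n 0); apply: le_cmean => x; exact: sqr_ge0.
  have -> : cmean (fun x : {ffun 'I_n.+1 -> 'I_n.+1} => (cavg (threshold R m c) x - l) ^+ 2) =
      cmean (fun x : {ffun 'I_n.+1 -> 'I_n.+1} => cavg (threshold R m c) x ^+ 2) -
      (2 * l) * cmean (fun x : {ffun 'I_n.+1 -> 'I_n.+1} => cavg (threshold R m c) x) + l ^+ 2.
    rewrite -(cmean_cst n (l ^+ 2)) -mulNr -cmeanZ -!cmeanD.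
    by congr cmean; apply/funext => x; ring.
  rewrite lerD2r lerB//; last first.
    rewrite /cavg cmeanZ cmean_sum.
    rewrite (eq_bigr (fun=> p s n)) => [|u _].
      by rewrite sumr_const card_ord -(mulr_natl (p s n)) mulKf.
    rewrite (cmean_rotate u (fun x : {ffun 'I_n.+1 -> 'I_n.+1} => threshold R m c (cyc x)))
      /p -sumE -cmean_ge ?sumE; last by lia.
    by congr cmean; apply/funext => x; rewrite threshold_cyc.
  rewrite cmean_cavg_sqr.
  (* The shifts for which the two windows overlap: at most [2 m] of them, each contributing at most
     1. *)
  pose bad := [set v : 'I_n.+1 | (v < m)%N || (n.+1 < v + m)%N]%SET.
  have p0 : 0 <= p s.*2 n by rewrite divr_ge0.
  apply: (@le_trans _ _ (n.+1%:R^-1 * \sum_(v < n.+1) (p s.*2 n + (v \in bad)%:R))).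
    rewrite ler_pM2l ?invr_gt0//; apply: ler_sum => v _.
    have [vb|] := boolP (v \in bad).
      rewrite -[leLHS]add0r lerD// -(cmean_cst n (1:R)); apply: le_cmean => x.
      by rewrite -[leRHS]mulr1 ler_pM ?threshold_ge0 ?threshold_le1.
    rewrite inE negb_or -!leqNgt addr0 => /andP[mv vm].
    have sumE2 : (\sum_(i < n.+1) ((if (i < m)%N then c i else 0) +
      (if ((i - v)%R < m)%N then c (i - v)%R else 0)) = s.*2)%N.
      rewrite big_split -addnn; congr addn; first exact: sumE.
      rewrite -sumE [LHS](reindex_inj (addIr v)).
      by apply: eq_bigr => i _; rewrite addrK.
    rewrite /p -sumE2 -cmean_ge ?sumE2//.
    by apply: le_cmean => x; rewrite threshold_cycM.
  rewrite big_split /= sumr_const card_ord -(mulr_natl (p _ _)) mulrDr mulKf//.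
  rewrite lerD2l mulrC ler_pM2r ?invr_gt0// -natr_sum ler_nat.
  rewrite -big_mkcond sum1_card /=.
  have -> : bad = [set v : 'I_n.+1 | v < m]%N%SET :|: [set v : 'I_n.+1 | n.+1 < v + m]%N%SET.
    by apply/finset.setP => v; rewrite !inE.
  rewrite -addnn (leq_trans (leq_card_setU _ _))// leq_add//.
    by apply: (@card_ord_leq _ 0%N) => v; rewrite inE add0n.
  by apply: (@card_ord_leq _ (n.+1 - m)) => v; rewrite inE; have := ltn_ord v; lia.
- exact: cvg_cst.
- have -> : (0 : R) = 2 ^- s.*2 + m.*2%:R * 0 - (2 * l) * l + l ^+ 2.
    by rewrite -addnn exprD invfM -/l; ring.
  apply: cvgD; last exact: cvg_cst.
  apply: cvgB; last by apply: cvgMr; exact: cvg_bin.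
  apply: cvgD; first exact: cvg_bin.
  by apply: cvgMr; exact: cvg_harmonic.
Unshelve. all: by end_near. Qed.

End threshold_averages.

(* A function of truncated windows is a combination of threshold events, since
   [w k = v] iff [v <= w k] but not [v + 1 <= w k]. *)
Lemma window_ind (R : realType) (P : ((nat -> nat) -> R) -> R -> Prop) (m : nat) :
  (forall F G l k, P F l -> P G k -> P (fun w => F w + G w) (l + k)) ->
  (forall a F l, P F l -> P (fun w => a * F w) (a * l)) ->
  (forall c, P (threshold R m c) (2 ^- psum c m)) ->
  forall (K : nat) (F : (nat -> nat) -> R),
    (forall w w', (forall k, (k < m)%N -> minn (w k) K = minn (w' k) K) -> F w = F w') ->
    exists l, P F l.
Proof.
move=> PD PZ Pthr K F FK.
(* Inequalities are turned into equalities one position at a time: an equality at [j] is the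
   difference of the events for [c] and for [c] increased by 1 at [j]. *)
have mixed (q : nat -> bool) j : (j <= m)%N -> forall c : nat -> nat, exists l,
    P (fun w => [forall k : 'I_m, if (k < j)%N && q k then w k == c k
                                 else (c k <= w k)%N]%:R) l.
  elim: j => [_ c|j IH jm c]; first by exists (2 ^- psum c m); exact: Pthr.
  have [qj|qj] := boolP (q j); last first.
    have [l Pl] := IH (ltnW jm) c; exists l.
    congr (P _ l): Pl; apply/funext => w; congr (nat_of_bool _)%:R.
    apply: eq_forallb => k; rewrite ltnS [(k <= j)%N]leq_eqVlt.
    by case: (eqVneq (k : nat) j) => [->|//]; rewrite ltnn (negbTE qj).
  have [l Pl] := IH (ltnW jm) c.
  have [l' Pl'] := IH (ltnW jm) (fun k => c k + (k == j))%N.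
  exists (l + -1 * l'); congr (P _ _): (PD _ _ _ _ Pl (PZ (-1) _ _ Pl')).
  apply/funext => w.
  pose A (k : 'I_m) := if (k < j)%N && q k then w k == c k else (c k <= w k)%N.
  pose J := Ordinal jm.
  have A1 : [forall k : 'I_m, if (k < j)%N && q k then w k == (c k + (k == j :> nat))%N
      else (c k + (k == j :> nat) <= w k)%N] =
      [forall (k : 'I_m | k != J), A k] && (c j < w j)%N.
    apply/forallP/andP => [h|[/forallP h hj] k].
      split; last by have := h J; rewrite /= ltnn /= eqxx addn1.
      apply/forallP => k; apply/implyP => kJ; have := h k.
      have -> : (k == j :> nat) = false by apply/negbTE; apply: contra kJ => /eqP e;
        apply/eqP/val_inj.
      by rewrite addn0.
    have [->|kJ] := eqVneq k J; first by rewrite /= ltnn /= eqxx addn1.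
    have -> : (k == j :> nat) = false by apply/negbTE; apply: contra kJ => /eqP e;
      apply/eqP/val_inj.
    by rewrite addn0; have := h k; rewrite kJ.
  have A0 : [forall k : 'I_m, A k] = [forall (k : 'I_m | k != J), A k] && (c j <= w j)%N.
    apply/forallP/andP => [h|[/forallP h hj] k].
      split; last by have := h J; rewrite /A /= ltnn.
      by apply/forallP => k; apply/implyP => _; exact: h.
    have [->|kJ] := eqVneq k J; first by rewrite /A /= ltnn.
    by have := h k; rewrite kJ.
  have AS : [forall k : 'I_m, if (k < j.+1)%N && q k then w k == c k else (c k <= w k)%N] =
      [forall (k : 'I_m | k != J), A k] && (w j == c j)%N.
    have out (k : 'I_m) : k != J -> (if (k < j.+1)%N && q k then w k == c k else (c k <= w
      k)%N) = A k.
      move=> kJ; rewrite /A ltnS [(k <= j)%N]leq_eqVlt.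
      by have -> : (k == j :> nat) = false by apply/negbTE; apply: contra kJ => /eqP e;
        apply/eqP/val_inj.
    apply/forallP/andP => [h|[/forallP h hj] k].
      split; last by have := h J; rewrite /= ltnSn qj.
      by apply/forallP => k; apply/implyP => kJ; rewrite -out.
    have [->|kJ] := eqVneq k J; first by rewrite /= ltnSn qj.
    by rewrite out//; have := h k; rewrite kJ.
  have -> : [forall k : 'I_m, if (k < j)%N && q k then w k == c k else (c k <= w k)%N] = _
    := A0.
  rewrite AS A1.
  by case: [forall (k : 'I_m | k != J), A k] => /=; rewrite ?mulr0 ?addr0//;
    case: (ltngtP (c j) (w j)) => _; rewrite ?mulr1 ?subrr ?mulr0 ?addr0.
pose ext (v : {ffun 'I_m -> 'I_K.+1}) (k : nat) : nat := oapp v ord0 (insub k : option 'I_m).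
have extE v (k : 'I_m) : ext v k = v k by rewrite /ext (valK k).
(* Here [v] runs over the windows truncated at [K]: a coordinate below [K] prescribes [w k] exactly,
   while the coordinate [K] stands for all [w k >= K]. *)
have -> : F = fun w => \sum_(v : {ffun 'I_m -> 'I_K.+1}) F (ext v) *
    [forall k : 'I_m, if (k < m)%N && (ext v k < K)%N then w k == ext v k
                      else (ext v k <= w k)%N]%:R.
  apply/funext => w.
  pose v0 : {ffun 'I_m -> 'I_K.+1} := [ffun k : 'I_m => inord (minn (w k) K)].
  have v0E (k : 'I_m) : ext v0 k = minn (w k) K.
    by rewrite extE ffunE inordK// ltnS geq_minr.
  rewrite (bigD1 v0)//= [X in _ + X]big1 => [|v vv0].
    rewrite addr0 (_ : [forall _, _])// ?mulr1.
      by apply: FK => k km; rewrite (v0E (Ordinal km)) /= -minnA minnn.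
    by apply/forallP => k; rewrite v0E ltn_ord /=; case: ifP; lia.
  rewrite (_ : [forall _, _] = false) ?mulr0//; apply: contraNF vv0 => /forallP h.
  apply/eqP/ffunP => k; apply/val_inj => /=; rewrite -extE -[RHS]extE v0E.
  by have := h k; rewrite ltn_ord extE; have := ltn_ord (v k); case: ifP; lia.
elim: (index_enum _) => [|v r [l Pl]].
  exists (0 * 2 ^- psum (fun=> 0%N) m); congr (P _ _): (PZ 0 _ _ (Pthr (fun=> 0%N))).
  by apply/funext => w; rewrite big_nil mul0r.
have [l' Pl'] := mixed (fun k => ext v k < K)%N m (leqnn m) (ext v).
exists (F (ext v) * l' + l); congr (P _ _): (PD _ _ _ _ (PZ (F (ext v)) _ _ Pl') Pl).
by apply/funext => w; rewrite big_cons.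
Qed.

(** * Averages over permutations *)

(** Only the values of the sequence on [[-h, h)] matter; they are read from [w] at the indices
    [0, ..., 2 h - 1]. *)
Definition window_rp (h : nat) (w : nat -> nat) : rooted_perm :=
  restr h (walk_rp (fun t => w (absz (t + h%:Z)))).

Lemma window_rp_minn h w w' :
  (forall k, (k < h.*2)%N -> minn (w k) h.*2 = minn (w' k) h.*2) ->
  window_rp h w = window_rp h w'.
Proof. by move=> ww'; apply: restr_walk_rp => t th; apply: ww'; lia. Qed.

Lemma restr_walk_rp_window h (d : int -> nat) :
  restr h (walk_rp d) = window_rp h (fun k => d (k%:Z - h%:Z)).
Proof. by apply: restr_walk_rp => t th; congr (minn (d _) _); lia. Qed.

(** Position [i] has index [i.+1] in the code and its window starts [h] earlier, hence the rotation
    by [u = i + 1 - h]. *)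
Lemma restr_root_at_window h n (s : 'S_n.+1) (x : {ffun 'I_n.+2 -> 'I_n.+2}) i (u : 'I_n.+2) :
  codes x s -> (h <= i)%N -> (i + h <= n)%N -> (u + h = i.+1)%N ->
  restr h (root_at s (inord i)) = window_rp h (cyc (rotate u x)).
Proof.
move=> xs hi ih uE.
have iE : (inord i : 'I_n.+1) = i :> nat by rewrite inordK//; lia.
rewrite (@restr_root_at h n s (inord i) (fun t => cyc x (absz (t + i.+1%:Z)))); last first.
- move=> a b ab; rewrite (xs _ _ ab) -(@overE (cyc x) (fun t => cyc x (absz (t + i.+1%:Z)))
  _ _ (a%:Z - (inord i : 'I_n.+1)%:Z) (b%:Z - (inord i : 'I_n.+1)%:Z))//.
  + by rewrite iE; lia.
  + by move=> k _; congr (cyc x _); rewrite iE; lia.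
- by rewrite iE.
- by rewrite iE.
by apply: restr_walk_rp => t th; rewrite cyc_rotate; congr (minn (cyc x _) _); lia.
Qed.

Section transfer.
Variable R : realType.

Definition perm_avg (G : rooted_perm -> R) n (s : 'S_n.+1) : R :=
  n.+1%:R^-1 * \sum_i G (root_at s i).

Lemma norm_sum_nat_le (f : nat -> R) (M : R) (a b : nat) :
  (forall i, `|f i| <= M) -> `|\sum_(a <= i < b) f i| <= (b - a)%:R * M.
Proof.
move=> fM; apply: (le_trans (ler_norm_sum _ _ _)).
apply: (le_trans (ler_sum _ (fun i _ => fM i))).
by rewrite sumr_const_nat mulr_natl.
Qed.

(** The roots [h, ..., n - h] match the rotations [1, ..., n + 1 - 2 h]. The remaining [2 h] roots
    and [2 h + 1] rotations cost [M] each, and replacing the factor [1 / (n + 1)] by [1 / (n + 2)]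
    costs one more [M]. *)
Lemma perm_avg_cavg (h : nat) (G : rooted_perm -> R) (M : R) n (s : 'S_n.+1)
    (x : {ffun 'I_n.+2 -> 'I_n.+2}) :
  (forall y, `|G y| <= M) -> (h.*2 <= n)%N -> codes x s ->
  `|perm_avg (G \o restr h) s - cavg (G \o window_rp h) x| <=
    (h.*2.*2).+2%:R * M * n.+2%:R^-1.
Proof.
move=> GM hn xs.
pose g i := G (restr h (root_at s (inord i))).
pose f u := G (window_rp h (cyc (rotate (inZp u : 'I_n.+2) x))).
have gS : \sum_i (G \o restr h) (root_at s i) = \sum_(0 <= i < n.+1) g i.
  by rewrite big_mkord; apply: eq_bigr => i _; rewrite /g inord_val.
have fS : \sum_u (G \o window_rp h) (cyc (rotate u x)) = \sum_(0 <= u < n.+2) f u.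
  by rewrite big_mkord; apply: eq_bigr => i _; rewrite /f valZpK.
have mid : \sum_(h <= i < n.+1 - h) g i = \sum_(1 <= u < n.+2 - h.*2) f u.
  rewrite -{1}(add0n h) big_addn -{1}(add0n 1%N) big_addn.
  have -> : (n.+1 - h - h = n.+2 - h.*2 - 1)%N by lia.
  apply: eq_big_nat => k /andP[_ hk]; rewrite /g /f.
  rewrite (@restr_root_at_window h n s x (k + h) (inZp (k + 1)) xs); try lia.
  - by [].
  - by rewrite /= modn_small; lia.
have gM i : `|g i| <= M by exact: GM.
have fM i : `|f i| <= M by exact: GM.
have M0 : 0 <= M by exact: le_trans (gM 0%N).
have gE : \sum_(0 <= i < n.+1) g i = \sum_(0 <= i < h) g i +
    (\sum_(h <= i < n.+1 - h) g i + \sum_(n.+1 - h <= i < n.+1) g i).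
  rewrite (@big_cat_nat _ _ _ h)//=; last by lia.
  by congr (_ + _); rewrite (@big_cat_nat _ _ _ (n.+1 - h)%N)//=; lia.
have fE : \sum_(0 <= i < n.+2) f i = \sum_(0 <= i < 1) f i +
    (\sum_(1 <= i < n.+2 - h.*2) f i + \sum_(n.+2 - h.*2 <= i < n.+2) f i).
  rewrite (@big_cat_nat _ _ _ 1%N)//=.
  by congr (_ + _); rewrite (@big_cat_nat _ _ _ (n.+2 - h.*2)%N)//=; lia.
have n2 : n.+2%:R != 0 :> R by rewrite pnatr_eq0.
have n1 : n.+1%:R != 0 :> R by rewrite pnatr_eq0.
rewrite ler_pdivlMr ?ltr0n// -[X in _ * X]ger0_norm// -normrM.
rewrite /perm_avg /cavg gS fS mulrBl [X in _ - X]mulrAC mulVf// mul1r.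
have -> : n.+1%:R^-1 * (\sum_(0 <= i < n.+1) g i) * n.+2%:R =
    n.+1%:R^-1 * (\sum_(0 <= i < n.+1) g i) + \sum_(0 <= i < n.+1) g i.
  by rewrite -[n.+2]addn1 natrD mulrDr mulr1 addrC; congr (_ + _);
    rewrite mulrAC mulVf// mul1r.
have A1 : `|n.+1%:R^-1 * (\sum_(0 <= i < n.+1) g i)| <= M.
  rewrite normrM ger0_norm ?invr_ge0// ler_pdivrMl ?ltr0n//.
  by have := norm_sum_nat_le 0 n.+1 gM; rewrite subn0.
have A2 := norm_sum_nat_le 0 h gM; have A3 := norm_sum_nat_le (n.+1 - h) n.+1 gM.
have A4 := norm_sum_nat_le 0 1 fM; have A5 := norm_sum_nat_le (n.+2 - h.*2) n.+2 fM.
move: A1 A2 A3 A4 A5; rewrite gE fE mid !subn0 !subKn; try lia.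
have -> : (h.*2.*2).+2%:R = 1 + h%:R + h%:R + 1 + h.*2%:R :> R.
  by rewrite -!natr1 -!muln2 !natrM; ring.
rewrite !mulrDl !mul1r.
move: (_ * (_ + _)) => a1; move: (\sum_(0 <= i < h) _) => a2.
move: (\sum_(n.+1 - h <= i < _) _) => a3; move: (\sum_(0 <= i < 1) _) => a4.
move: (\sum_(n.+2 - _ <= i < n.+2) _) => a5; move: (\sum_(1 <= i < _) _) => a6.
move: (h%:R * M) (h.*2%:R * M) => b1 b2.
rewrite !ler_norml => /andP[? ?] /andP[? ?] /andP[? ?] /andP[? ?] /andP[? ?].
by apply/andP; split; lra.
Qed.

Lemma cavg_rotate (F : (nat -> nat) -> R) n (u : 'I_n.+1) (x : {ffun 'I_n.+1 -> 'I_n.+1}) :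
  cavg F (rotate u x) = cavg F x.
Proof.
rewrite /cavg; congr (_ * _); rewrite [RHS](reindex_inj (addrI u)) /=.
by apply: eq_bigr => v _; rewrite rotateD.
Qed.

Lemma Av231_gt0 n : (0 < #|Av231 n|)%N.
Proof.
apply: leq_trans (card_good_compositions n).
have := card_compositions_le n; have : (0 < #|compositions n|)%N.
  by have := compositions_gt0 R n; rewrite ltr0n.
lia.
Qed.

(** Chebyshev's inequality for the cyclic average of a uniform composition, whose deviation event is
    rotation invariant and so transfers to permutations. Halving [e] absorbs the boundary error. *)
Lemma cvg_Av231_avg (h : nat) (G : rooted_perm -> R) (M l e : R) :
  (forall y, `|G y| <= M) -> cvg_avg (G \o window_rp h) l -> 0 < e ->
  (#|Av231 n.+1 :&: [set s | e < `|perm_avg (G \o restr h) s - l|]%SET|%:R /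
   #|Av231 n.+1|%:R : R) @[n --> \oo] --> (0 : R).
Proof.
move=> GM Gl e0; pose F := G \o window_rp h.
pose m2 n := cmean (fun x : {ffun 'I_n.+1 -> 'I_n.+1} => (cavg F x - l) ^+ 2).
have e20 : 0 < (e / 2) ^+ 2 by rewrite exprn_gt0// divr_gt0.
apply: (@squeeze_cvgr _ _ _ _ (fun=> 0) (fun n => ((e / 2) ^+ 2)^-1 * m2 n.+1)); last 2 first.
- exact: cvg_cst.
- rewrite -(mulr0 ((e / 2) ^+ 2)^-1); apply: cvgMr.
  by move: Gl; rewrite /cvg_avg -cvg_shiftS.
have h0 : ((h.*2.*2).+2%:R * M * n.+1%:R^-1 : R) @[n --> \oo] --> (0 : R).
  by rewrite -(mulr0 ((h.*2.*2).+2%:R * M)); apply: cvgMr; exact: cvg_harmonic.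
have he : \forall n \near \oo, (h.*2.*2).+2%:R * M * n.+1%:R^-1 < e / 2.
  have e2 : 0 < e / 2 by rewrite divr_gt0.
  apply: filterS (cvgr0_norm_lt _ h0 _ e2) => n; apply: le_lt_trans; exact: ler_norm.
near=> n.
have hn : (h.*2 <= n)%N by near: n; exact: nbhs_infty_ge.
have hen : (h.*2.*2).+2%:R * M * n.+2%:R^-1 < e / 2.
  have : forall k, (n < k)%N -> (h.*2.*2).+2%:R * M * k.+1%:R^-1 < e / 2.
    by near: n; case: he => N _ hN; exists N => // n /= Nn k nk; apply: hN => /=; lia.
  exact.
apply/andP; split; first by rewrite divr_ge0.
rewrite ler_pdivrMr ?ltr0n ?Av231_gt0//.
pose P := [set s : 'S_n.+1 | e < `|perm_avg (G \o restr h) s - l|]%SET.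
pose Q := [set x : {ffun 'I_n.+2 -> 'I_n.+2} | e / 2 < `|cavg F x - l|]%SET.
have PQ : forall s x, s \in P -> x \in good_compositions n.+1 -> codes x s -> x \in Q.
  move=> s x; rewrite !inE => sP _ xs.
  have d := le_lt_trans (perm_avg_cavg GM hn xs) hen.
  have := lt_le_trans sP (ler_distD (cavg F x) (perm_avg (G \o restr h) s) l).
  move: d; rewrite -/F; move: `|_ - cavg F x| `|_ - l| => a b; lra.
have Qrot : forall u x, x \in Q -> rotate u x \in Q.
  by move=> u x; rewrite !inE cavg_rotate.
have X0 := compositions_gt0 R n.+1.
have := card_Av231_compositions Qrot PQ.
rewrite -(ler_nat R) !natrM -/P => hle.
rewrite -(ler_pM2r X0); apply: (le_trans hle).
rewrite mulrAC ler_wpM2r//.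
rewrite /m2 /cmean mulrCA mulrAC mulVf ?gt_eqF// mul1r.
rewrite mulrC ler_pdivlMr// -sum1_card natr_sum mulr_suml.
rewrite [leRHS](bigID (mem Q)) /= -[leLHS]addr0 lerD//.
  rewrite (eq_bigl (fun x => (x \in compositions n.+1) && (x \in Q))); last first.
    by move=> x; rewrite finset.in_setI.
  apply: ler_sum => x /andP[_]; rewrite inE mul1r => hx.
  by rewrite -[leRHS]real_normK ?num_real// lerXn2r// ?nnegrE ?ltW// divr_gt0.
by apply: sumr_ge0 => x _; exact: sqr_ge0.
Unshelve. all: by end_near. Qed.

End transfer.

(** * The limiting geometric sequence *)

Section unit_prob.
Variable R : realType.

Local Notation TR := (measurableTypeR R).

Definition unit_prob : set TR -> \bar R :=
  mrestr (@lebesgue_measure R) (measurable_itv `[0, 1[).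

Let m : {measure set TR -> \bar R} := mrestr (@lebesgue_measure R) (measurable_itv `[0, 1[).

HB.instance Definition _ := isMeasure.Build _ _ _ unit_prob
  (measure0 m) (measure_ge0 m) (@measure_semi_sigma_additive _ _ _ m).

Let unit_prob_setT : unit_prob setT = 1%E.
Proof. by rewrite /unit_prob /mrestr setTI lebesgue_measure_itv /= lte_fin ltr01 sube0. Qed.

HB.instance Definition _ := Measure_isProbability.Build _ _ R unit_prob unit_prob_setT.

Definition dyadic (i k : nat) : set TR := `[k%:R * 2 ^- i, k.+1%:R * 2 ^- i[%classic.

Lemma dyadic_split i k : dyadic i k = dyadic i.+1 k.*2 `|` dyadic i.+1 k.*2.+1.
Proof.
have e1 : k.*2%:R * 2 ^- i.+1 = k%:R * 2 ^- i :> R.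
  by rewrite exprS invfM mulrA -muln2 natrM mulfK// pnatr_eq0.
have e2 : k.*2.+2%:R * 2 ^- i.+1 = k.+1%:R * 2 ^- i :> R.
  by rewrite -doubleS exprS invfM mulrA -muln2 natrM mulfK// pnatr_eq0.
rewrite /dyadic e1 e2 -itv_bndbnd_setU//= bnd_simp.
  by rewrite -e1 ler_pM2r ?invr_gt0 ?exprn_gt0// ler_nat.
by rewrite -e2 ler_pM2r ?invr_gt0 ?exprn_gt0// ler_nat.
Qed.

Lemma dyadic_disj i k l : k != l -> dyadic i k `&` dyadic i l = set0.
Proof.
wlog kl : k l / (k < l)%N.
  move=> wl kl; case: (ltngtP k l) kl => // h _; last rewrite setIC.
    by apply: wl => //; rewrite neq_ltn h.
  by apply: wl => //; rewrite neq_ltn h.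
move=> _; apply/seteqP; split=> // w [] /=; rewrite /dyadic /= !in_itv /=.
move=> /andP[_ h1] /andP[h2 _]; have := le_lt_trans h2 h1.
by rewrite ltr_pM2r ?invr_gt0 ?exprn_gt0// ltr_nat; lia.
Qed.

Lemma measurable_dyadic i k : measurable (dyadic i k).
Proof. exact: measurable_itv. Qed.

(* The [j]-th binary digit of [w], [false] for negative [w]. *)
Definition bit (j : nat) (w : R) : Prop := exists k, dyadic j.+1 k.*2.+1 w.

Lemma measurable_bit j : measurable ([set w | bit j w] : set TR).
Proof.
have -> : [set w | bit j w] = \bigcup_k dyadic j.+1 k.*2.+1.
  by apply/seteqP; split=> w /= [k]; exists k.
by apply: bigcup_measurable => k _; exact: measurable_dyadic.
Qed.

Lemma bit_dyadic i k w : dyadic i k w -> bit i w <-> dyadic i.+1 k.*2.+1 w.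
Proof.
move=> wk; split=> [[l wl]|h]; last by exists k.
have wl' : dyadic i l w by rewrite dyadic_split; right.
have [<-//|kl] := eqVneq l k.
by have := dyadic_disj i kl; move=> /seteqP[/(_ w)]; case.
Qed.

Definition bits_one (J : pred nat) (i n : nat) : set TR :=
  [set w | forall j, (i <= j < i + n)%N -> J j -> bit j w].

Lemma measurable_bits_one J i n : measurable (bits_one J i n).
Proof.
have -> : bits_one J i n = \bigcap_j (if (i <= j < i + n)%N && J j then [set w | bit j w]
  else setT).
  apply/seteqP; split=> w h j => [_|jn Jj]; first by case: ifP => // /andP[? ?]; exact: h.
  by have := h j I; rewrite jn Jj.
apply: bigcap_measurableType => j _; case: ifP => _;
  [exact: measurable_bit|exact: measurableT].
Qed.

(** Induction on the number of digits, for all dyadic intervals at once: a prescribed digit keeps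
    only the right half of the interval, a free one keeps both halves. *)
Lemma lebesgue_bits_one J n : forall i k,
  lebesgue_measure (dyadic i k `&` bits_one J i n) =
  (2 ^- i * 2 ^- count J (iota i n))%:E :> \bar R.
Proof.
elim: n => [i k|n IH i k].
  have -> : bits_one J i 0 = setT.
    by apply/seteqP; split=> // w _ j; rewrite addn0; lia.
  rewrite setIT /dyadic lebesgue_measure_itv /= lte_fin.
  rewrite ltr_pM2r ?invr_gt0 ?exprn_gt0// ltr_nat ltnSn -EFinB.
  by rewrite -mulrBl -natr1 addrAC subrr add0r expr0 invr1 mulr1 mul1r.
pose B := bits_one J i.+1 n.
have BE : bits_one J i n.+1 = (if J i then [set w | bit i w] else setT) `&` B.
  apply/seteqP; split=> [w h|w [h1 h2] j jn Jj].
    split; first by case: ifP => // Ji; apply: (h i) => //; lia.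
    by move=> j jn Jj; apply: h => //; lia.
  have [ji|ji] := eqVneq j i; first by move: h1; rewrite -ji Jj.
  by apply: h2 => //; lia.
have IH0 := IH i.+1 k.*2; have IH1 := IH i.+1 k.*2.+1.
rewrite -/B in IH0 IH1.
rewrite BE /=; case: ifPn => Ji /=.
  have -> : dyadic i k `&` ([set w | bit i w] `&` B) = dyadic i.+1 k.*2.+1 `&` B.
    apply/seteqP; split=> w.
      by move=> [wk [/(bit_dyadic wk) h wB]].
    move=> [h wB]; have wk : dyadic i k w by rewrite dyadic_split; right.
    by split=> //; split=> //; apply/(bit_dyadic wk).
  by rewrite IH1 add1n !exprS; congr _%:E; rewrite !invfM; ring.
rewrite setTI dyadic_split setIUl measureU; last 3 first.
- by apply: measurableI; [exact: measurable_dyadic|exact: measurable_bits_one].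
- by apply: measurableI; [exact: measurable_dyadic|exact: measurable_bits_one].
- have := @dyadic_disj i.+1 k.*2 k.*2.+1; rewrite setIACA => ->; first by rewrite set0I.
  by rewrite neq_ltn ltnSn.
rewrite /= in IH0 IH1 *; rewrite [X in (X + _)%E]IH0 [X in (_ + X)%E]IH1 add0n -EFinD exprS
  invfM; congr _%:E; lra.
Qed.

Lemma unit_prob_bits (L : seq nat) : uniq L ->
  unit_prob [set w | forall j, j \in L -> bit j w] = (2 ^- size L)%:E.
Proof.
move=> uL; pose M := (\max_(j <- L) j).+1.
have LM j : j \in L -> (j < M)%N.
  by move=> jL; rewrite ltnS; exact: (@leq_bigmax_seq _ L xpredT (fun j => j) j jL isT).
have -> : [set w | forall j, j \in L -> bit j w] = bits_one (mem L) 0 M.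
  by apply/seteqP; split=> w h j => [_ jL|jL]; apply: h => //; exact: LM.
rewrite /unit_prob /mrestr setIC.
have -> : `[0, 1[%classic = dyadic 0 0 by rewrite /dyadic expr0 invr1 !mulr1.
rewrite lebesgue_bits_one expr0 invr1 mul1r -size_filter; congr (2 ^- _)%:E.
apply/perm_size/uniq_perm => //; first by rewrite filter_uniq// iota_uniq.
by move=> j; rewrite mem_filter mem_iota leq0n andbC /=;
  case: (boolP (j \in L)) => [/LM ->|]; rewrite ?andbF.
Qed.

End unit_prob.

(** * Independent geometric variables from binary digits *)

Section iid_geometric.
Variable R : realType.

(** [pickle] is injective on pairs, so distinct sites read disjoint sets of digits and are
    independent. *)
Definition site_bit (t : int) (j : nat) (w : R) : Prop := bit (pickle (t, j)) w.

Definition run_ge (t : int) (c : nat) : set (measurableTypeR R) :=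
  [set w | forall j, (j < c)%N -> site_bit t j w].

Definition run_infinite (t : int) : set (measurableTypeR R) :=
  [set w | forall j, site_bit t j w].

(* Junk value [0] on the null set [run_infinite t]. *)
Definition geom (w : R) (t : int) : nat :=
  if pselect (exists j, `[< ~ site_bit t j w >]) is left ex then ex_minn ex else 0.

Lemma geom_ge w t c : (c <= geom w t)%N <-> c = 0%N \/ (run_ge t c w /\ ~ run_infinite t w).
Proof.
rewrite /geom; case: pselect => [ex|nex].
  case: ex_minnP => m /asboolP nm mmin; split.
    move=> cm; right; split; last by move=> /(_ m).
    move=> j jc; apply: contrapT => /asboolP/mmin; lia.
  case=> [->//|[h _]]; rewrite leqNgt; apply/negP => mc; exact: nm (h _ mc).
have inf : run_infinite t w.
  by move=> j; apply: contrapT => nj; apply: nex; exists j; exact/asboolP.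
by rewrite leqn0; split=> [/eqP ->|[->//|[_ []]//]]; left.
Qed.

Lemma measurable_run_ge t c : measurable (run_ge t c).
Proof.
have -> : run_ge t c = \bigcap_j (if (j < c)%N then [set w | site_bit t j w] else setT).
  apply/seteqP; split=> w h j => [_|jc]; first by case: ifP => // jc; exact: h.
  by have := h j I; rewrite jc.
apply: bigcap_measurableType => j _; case: ifP => _;
  [exact: measurable_bit|exact: measurableT].
Qed.

Lemma measurable_run_infinite t : measurable (run_infinite t).
Proof.
have -> : run_infinite t = \bigcap_c run_ge t c.
  apply/seteqP; split=> w h; first by move=> c _ j _; exact: h.
  by move=> j; exact: (h j.+1 I).
by apply: bigcap_measurableType => c _; exact: measurable_run_ge.
Qed.

(** By injectivity of [pickle], the event prescribes [psum c m] distinct digits. *)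
Lemma unit_prob_run_ge (m h : nat) (c : nat -> nat) :
  unit_prob [set w : R | forall k, (k < m)%N -> run_ge (k%:Z - h%:Z) (c k) w] =
  (2 ^- psum c m)%:E.
Proof.
pose L := [seq pickle (k%:Z - h%:Z, j) | k <- iota 0 m, j <- iota 0 (c k)].
have -> : [set w : R | forall k, (k < m)%N -> run_ge (k%:Z - h%:Z) (c k) w] =
    [set w : R | forall j, j \in L -> bit j w].
  apply/seteqP; split=> w /= H.
    move=> _ /allpairsPdep[k [j [kL jL ->]]]; apply: H.
      by move: kL; rewrite mem_iota.
    by move: jL; rewrite mem_iota.
  move=> k km j jc; apply: H; apply/allpairsPdep; exists k, j; split=> //.
    by rewrite mem_iota.
  by rewrite mem_iota.
rewrite unit_prob_bits; last first.
  apply: allpairs_uniq_dep; [exact: iota_uniq|by move=> *; exact: iota_uniq|].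
  move=> [k j] [k' j'] _ _ /= /(pcan_inj pickleK)[kk ->].
  by have -> : k = k' by lia.
congr (2 ^- _)%:E; rewrite /L size_allpairs_dep sumnE big_map.
rewrite -{1}(subn0 m) -/(index_iota 0 m) big_mkord.
by apply: eq_bigr => k _; rewrite size_iota.
Qed.

Definition geom_window (h : nat) (w : R) (k : nat) : nat := geom w (k%:Z - h%:Z).

Definition geom_threshold (m h : nat) (c : nat -> nat) : set (measurableTypeR R) :=
  [set w | forall k, (k < m)%N -> (c k <= geom_window h w k)%N].

Lemma measurable_geom_threshold m h c : measurable (geom_threshold m h c).
Proof.
have -> : geom_threshold m h c = \bigcap_k (if (k < m)%N && (c k != 0)%N then
    run_ge (k%:Z - h%:Z) (c k) `&` ~` run_infinite (k%:Z - h%:Z) else setT).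
  apply/seteqP; split=> w H k => [_|km].
    by case: ifP => // /andP[km /eqP ck]; have /geom_ge[//|] := H k km.
  have := H k I; rewrite km /=; case: eqP => [-> //|ck Hk]; apply/geom_ge; right.
  exact: Hk.
apply: bigcap_measurableType => k _; case: ifP => _; last exact: measurableT.
apply: measurableI; first exact: measurable_run_ge.
by apply: measurableC; exact: measurable_run_infinite.
Qed.

Lemma unit_prob_run_ge1 t c : unit_prob (run_ge t c) = (2 ^- c)%:E.
Proof.
pose L := [seq pickle (t, j) | j <- iota 0 c].
have -> : run_ge t c = [set w : R | forall j, j \in L -> bit j w].
  apply/seteqP; split=> w /= H.
    by move=> _ /mapP[j jL ->]; apply: H; move: jL; rewrite mem_iota.
  by move=> j jc; apply: H; apply/mapP; exists j; rewrite ?mem_iota.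
rewrite unit_prob_bits ?size_map ?size_iota// map_inj_uniq ?iota_uniq//.
by move=> j j' /(pcan_inj pickleK)[].
Qed.

Lemma unit_prob_run_infinite t : unit_prob (run_infinite t) = 0.
Proof.
apply/eqP; rewrite eq_le measure_ge0 andbT; apply/lee_addgt0Pr => e e0.
rewrite add0e.
have [c ce] : exists c : nat, 2 ^- c < e.
  have : (2^-1 ^+ c : R) @[c --> \oo] --> (0 : R).
    by apply: cvg_expr; rewrite ger0_norm ?invr_ge0// invf_lt1// ltr1n.
  move=> /cvgr0_norm_lt /(_ _ e0)[c _ /(_ c (leqnn c))] h; exists c.
  by rewrite -exprVn; apply: le_lt_trans (ler_norm _) h.
apply: (@le_trans _ _ (unit_prob (run_ge t c))).
  apply: le_measure; rewrite ?inE; [exact: measurable_run_infinite|exact: measurable_run_ge|].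
  by move=> w h j _; exact: h.
by rewrite unit_prob_run_ge1 lee_fin ltW.
Qed.

(** This event and the one of [unit_prob_run_ge] differ only on the null set [Z] where some site in
    question has an infinite run of ones. *)
Lemma unit_prob_geom_threshold m h c :
  unit_prob (geom_threshold m h c) = (2 ^- psum c m)%:E.
Proof.
rewrite -(unit_prob_run_ge m h c).
set A := geom_threshold m h c; set B := [set w | _].
have mA : measurable A by exact: measurable_geom_threshold.
have mB : measurable B.
  have -> : B = \bigcap_k (if (k < m)%N then run_ge (k%:Z - h%:Z) (c k) else setT).
    apply/seteqP; split=> w H k => [_|km]; first by case: ifP => // km; exact: H.
    by have := H k I; rewrite km.
  by apply: bigcap_measurableType => k _; case: ifP => _;
    [exact: measurable_run_ge|exact: measurableT].
pose Z : set (measurableTypeR R) := \bigcup_k run_infinite (k%:Z - h%:Z).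
have mZ : measurable Z by apply: bigcup_measurable => k _; exact: measurable_run_infinite.
have Z0 : unit_prob Z = 0.
  apply/eqP; rewrite eq_le measure_ge0 andbT.
  apply: (le_trans (@measure_sigma_subadditive _ _ _ (unit_prob (R := R)) Z
    (fun k => run_infinite (k%:Z - h%:Z)) _ mZ _)) => //.
    by move=> k; exact: measurable_run_infinite.
  by rewrite eseries0// => k _ _; exact: unit_prob_run_infinite.
apply/eqP; rewrite eq_le; apply/andP; split.
  apply: le_measure; rewrite ?inE// => w H k km.
  have /geom_ge[->|[]//] := H k km; by [].
apply: (@le_trans _ _ (unit_prob (A `|` Z))).
  apply: le_measure; rewrite ?inE//; first exact: measurableU.
  move=> w H; have [wZ|nZ] := pselect (Z w); first by right.
  left=> k km; apply/geom_ge; right; split; first exact: H.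
  by move=> wk; apply: nZ; exists k.
by apply: (le_trans (measureU2 _ mA mZ)); rewrite [X in (_ + X)%E]Z0 adde0.
Qed.

(** The limit of cyclic averages and the mean under geometric variables are both linear in [F] and
    agree on thresholds, so [window_ind] applies to their conjunction. The same [l] serves for every
    [h] by stationarity. *)
Lemma limit_mean (m K : nat) (F : (nat -> nat) -> R) :
  (forall w w', (forall k, (k < m)%N -> minn (w k) K = minn (w' k) K) -> F w = F w') ->
  exists l, cvg_avg F l /\ forall h,
    (unit_prob (R := R)).-integrable setT (EFin \o (F \o geom_window h)) /\
    \int[unit_prob (R := R)]_w F (geom_window h w) = l.
Proof.
move: F; apply: (@window_ind R (fun F l => cvg_avg F l /\ forall h,
    (unit_prob (R := R)).-integrable setT (EFin \o (F \o geom_window h)) /\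
    \int[unit_prob (R := R)]_w F (geom_window h w) = l)).
- move=> F G l k [Fl Fi] [Gk Gi]; split; first exact: cvg_avgD.
  move=> h; have [iF eF] := Fi h; have [iG eG] := Gi h; split.
    exact: (integrableD measurableT iF iG).
  by rewrite -eF -eG -RintegralD.
- move=> a F l [Fl Fi]; split; first exact: cvg_avgZ.
  move=> h; have [iF eF] := Fi h; split.
    exact: (integrableZl measurableT a iF).
  by rewrite -eF -RintegralZl.
- move=> c; split; first exact: cvg_avg_threshold.
  move=> h; have mA := measurable_geom_threshold m h c.
  have E : (fun w => threshold R m c (geom_window h w)) = \1_(geom_threshold m h c).
    apply/funext => w; rewrite indicE /threshold; congr (nat_of_bool _)%:R.
    apply/forallP/idP => [H|]; first by rewrite inE => k km; exact: (H (Ordinal km)).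
    by rewrite inE => H k; exact: H.
  have -> : EFin \o (threshold R m c \o geom_window h) = EFin \o \1_(geom_threshold m h c).
    by rewrite -E.
  split; first exact: integrable_indic.
  rewrite E /Rintegral integral_indic// setIT.
  exact: (congr1 fine (unit_prob_geom_threshold m h c)).
Qed.

End iid_geometric.

(** * Quenched convergence *)

(** Agreement up to radius [h] gives distance at most [2 ^ - h], so every ball contains a cylinder
    around its centre. *)
Lemma nbhs_restr (R : realType) (x : rooted R) (A : set (rooted R)) :
  nbhs x A -> exists h, forall y : rooted R, restr h y = restr h x -> A y.
Proof.
move=> /nbhs_ballP[e /= e0 eA].
have [h he] : exists h : nat, 2^-1 ^+ h < e.
  have : (2^-1 ^+ c : R) @[c --> \oo] --> (0 : R).
    by apply: cvg_expr; rewrite ger0_norm ?invr_ge0// invf_lt1// ltr1n.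
  move=> /cvgr0_norm_lt /(_ _ e0)[c _ /(_ c (leqnn c))] h; exists c.
  exact: le_lt_trans (ler_norm _) h.
exists h => y yx; apply: eA; rewrite ballEmdist /=.
change (local_dist R x y < e).
have [[_ ->]//|[k [kP ->]]] := local_distP R x y.
apply: le_lt_trans he; rewrite exprVn -powR_mulrn// -powRN.
apply: ler_powR; first by rewrite ler1n.
by rewrite lerN2 ler_nat; apply/kP.
Qed.

Lemma continuous_restr (R : realType) (f : rooted R -> R) (x : rooted R) (e : R) :
  continuous f -> 0 < e ->
  exists h, forall y : rooted R, restr h y = restr h x -> `|f x - f y| < e.
Proof.
by move=> cf e0; apply: nbhs_restr; exact: (cf x _ (nbhsx_ballx (f x) e e0)).
Qed.

(** * Integrals against root laws, and convergence in probability *)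

Section law_of_permutation.
Variable R : realType.

Lemma measurable_continuous_borel (E : ptopologicalType) (f : E -> R) :
  continuous f -> measurable_fun [set: borel E] (f : borel E -> R).
Proof.
move=> /continuousP cf; apply: (measurability _ (RGenOInfty.measurableE R)).
move=> _ [_ [x ->] <-]; rewrite setTI; apply: sub_sigma_algebra; apply: cf.
exact: rray_open.
Qed.

Lemma integral_root_law (f : rooted R -> R) (M : R) (p : perms) :
  measurable_fun [set: borel (rooted R)] (f : borel (rooted R) -> R) ->
  (forall x, `|f x| <= M) ->
  \int[root_law p : probability (borel (rooted R)) R]_x f x = perm_avg f (tagged p).
Proof.
move=> mf fM.
(* Adding [M] makes the integrand nonnegative, so that its integral against a scaled finite sum of
   Dirac masses can be computed termwise; the shift is removed at the end. *)
have mfM : measurable_fun [set: borel (rooted R)] (fun x : borel (rooted R) => f x + M).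
  by apply: measurable_funD => //; exact: measurable_cst.
have f0 x : (0 <= (f x + M)%:E)%E.
  by have := fM x; rewrite ler_norml lee_fin => /andP[? _]; lra.
have bf : [bounded f x | x in [set: borel (rooted R)]].
  exists M; split; first exact: num_real.
  by move=> y My x _; apply: le_trans (fM x) (ltW My).
have intf (mu : probability (borel (rooted R)) R) : mu.-integrable setT (EFin \o f).
  apply: (measurable_bounded_integrable measurableT _ mf bf).
  exact: (le_lt_trans (probability_le1 mu measurableT) (ltry 1)).
have intM (mu : probability (borel (rooted R)) R) : mu.-integrable setT (EFin \o (fun=> M)).
  exact: finite_measure_integrable_cst.
have shift : \int[root_law p : probability (borel (rooted R)) R]_x (f x + M) =
    perm_avg f (tagged p) + M.
  rewrite /Rintegral.
  rewrite (@eq_measure_integral _ _ _ _ (mscale ((tag p).+1%:R^-1 : R)%:nng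
    (msum (fun k : nat => \d_(root_at (tagged p) (inord k) : borel (rooted R)))
          (tag p).+1))); last first.
    move=> A _ _; rewrite /= /root_law /mscale /= /msum /=.
    by congr (_ * _)%E; apply: eq_bigr => i _; rewrite inord_val.
  rewrite ge0_integral_mscale//; last exact/measurable_EFinP.
  rewrite ge0_integral_measure_sum//; last exact/measurable_EFinP.
  rewrite (eq_bigr (fun i : 'I_(tag p).+1 => (f (root_at (tagged p) i) + M)%:E)); last first.
    move=> i _; rewrite integral_dirac//; last exact/measurable_EFinP.
    by rewrite diracT mul1e inord_val.
  rewrite sumEFin -EFinM /= /perm_avg big_split /= mulrDr; congr (_ + _).
  by rewrite sumr_const card_ord -(mulr_natl M) mulKf.
move: shift; rewrite (RintegralD measurableT (intf _) (intM _)).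
have -> : \int[root_law p : probability (borel (rooted R)) R]_x M = M.
  by rewrite Rintegral_cst//= probability_setT /= mulr1.
by move/addIr.
Qed.

(** Convergence along this filter is convergence in probability for uniform 231-avoiding
    permutations: its members are the sets whose complement has a vanishing proportion. *)
Definition prob_filter : set_system perms := fun A =>
  (#|Av231 n.+1 :&: [set s | `[< ~ A (mkperms s) >]]%SET|%:R / #|Av231 n.+1|%:R : R)
    @[n --> \oo] --> (0 : R).

#[global] Instance prob_filter_filter : Filter prob_filter.
Proof.
have sub n (A B : set perms) : (A `<=` B) ->
   (#|Av231 n.+1 :&: [set s | `[< ~ B (mkperms s) >]]%SET| <=
    #|Av231 n.+1 :&: [set s | `[< ~ A (mkperms s) >]]%SET|)%N.
  move=> AB; apply/subset_leq_card/finset.setIS/fintype.subsetP => s; rewrite !finset.in_set.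
  by move=> /asboolP nB; apply/asboolP => /AB.
constructor.
- rewrite /prob_filter; apply: cvg_near_cst; apply: nearW => n.
  rewrite (_ : [set s | _]%SET = finset.set0) ?finset.setI0 ?cards0 ?mul0r//.
  by apply/finset.setP => s; rewrite finset.in_set finset.in_set0 asboolF//; apply; exact: I.
- move=> A B FA FB; rewrite /prob_filter.
  apply: (@squeeze_cvgr _ _ _ _ (fun=> 0)); [|exact: cvg_cst|by rewrite -(addr0 0);
    exact: cvgD FA FB].
  apply: nearW => n; apply/andP; split; first by rewrite divr_ge0.
  rewrite /= -mulrDl ler_pM2r ?invr_gt0 ?ltr0n ?(Av231_gt0 R)// fctE -natrD ler_nat.
  apply: leq_trans (leq_card_setU _ _); apply/subset_leq_card/fintype.subsetP => s.
  rewrite finset.in_setU !finset.in_setI; case: (s \in Av231 n.+1) => //=;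
    rewrite !finset.in_set => /asboolP h.
  by move/not_andP: h => [nA|nB]; apply/orP; [left|right]; exact/asboolP.
- move=> A B AB FA; rewrite /prob_filter.
  apply: (@squeeze_cvgr _ _ _ _ (fun=> 0) _ _ _ _ (cvg_cst _) FA).
  apply: nearW => n; apply/andP; split; first by rewrite divr_ge0.
  by rewrite ler_pM2r ?invr_gt0 ?ltr0n ?(Av231_gt0 R)// ler_nat sub.
Qed.

End law_of_permutation.

(** * The limiting random rooted permutation *)

Section limit_object.
Variable R : realType.
Local Notation P := (unit_prob (R := R)).

Definition limit_perm (w : measurableTypeR R) : borel (rooted R) := walk_rp (geom w).

Lemma restr_limit_perm h w : restr h (limit_perm w) = window_rp h (geom_window h w).
Proof. exact: restr_walk_rp_window. Qed.

(** The case of functions of a finite window. Integrability is part of the conclusion and later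
    yields the measurability of [limit_perm]. *)
Lemma cylinder_limit h (G : rooted_perm -> R) (M : R) : (forall y, `|G y| <= M) ->
  P.-integrable setT (EFin \o (fun w => G (restr h (limit_perm w)))) /\
  perm_avg (G \o restr h) (tagged p) @[p --> prob_filter R] -->
    \int[P]_w G (restr h (limit_perm w)).
Proof.
move=> GM.
have [l [Gl]] := @limit_mean R h.*2 h.*2 (G \o window_rp h)
  (fun w w' ww' => congr1 G (window_rp_minn ww')).
move=> /(_ h)[]; have -> : (G \o window_rp h) \o geom_window h =
    (fun w => G (restr h (limit_perm w))).
  by apply/funext => w; rewrite restr_limit_perm.
move=> iG eG; split=> //.
have -> : \int[P]_w G (restr h (limit_perm w)) = l.
  by rewrite -eG; congr Rintegral; apply/funext => w; rewrite restr_limit_perm.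
apply/cvgrPdist_lt => e e0.
change (prob_filter R [set p | `|l - perm_avg (G \o restr h) (tagged p)| < e]).
have e20 : 0 < e / 2 by rewrite divr_gt0.
(* A deviation of at least [e] exceeds [e / 2], which matches the strict inequality in
   [cvg_Av231_avg]. *)
apply: (@squeeze_cvgr _ _ _ _ (fun=> 0) _ _ _ _ (cvg_cst _) (cvg_Av231_avg GM Gl e20)).
apply: nearW => n; apply/andP; split; first by rewrite divr_ge0.
rewrite ler_pM2r ?invr_gt0 ?ltr0n ?(Av231_gt0 R)// ler_nat.
apply/subset_leq_card/finset.setIS/fintype.subsetP => s; rewrite !finset.in_set.
move=> /asboolP /negP; rewrite -leNgt distrC => h1; apply: lt_le_trans h1.
by rewrite ltr_pdivrMr// mulr_natr mulr2n ltrDl.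
Qed.

(** The indicator of any property of the window is a bounded cylinder function, hence integrable and
    in particular measurable. *)
Lemma measurable_cylinder h (Phi : rooted_perm -> Prop) :
  measurable ([set w | Phi (restr h (limit_perm w))] : set (measurableTypeR R)).
Proof.
pose G y : R := `[< Phi y >]%:R.
have GM y : `|G y| <= 1 by rewrite ger0_norm ?ler0n// lern1 leq_b1.
have [iG _] := cylinder_limit h GM.
have /measurable_EFinP mG := measurable_int _ iG.
have := mG measurableT [set 1] (measurable_set1 1); rewrite setTI.
congr measurable; apply/seteqP; split=> w /=; rewrite /G.
  by case: asboolP => // _ /eqP; rewrite eq_sym oner_eq0.
by move=> h1; rewrite asboolT.
Qed.

(** An open set is the countable union over [h] of the unions of cylinders of radius [h] that it
    contains. *)
Lemma measurable_limit_perm : measurable_fun setT limit_perm.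
Proof.
apply: (@measurability _ _ _ (borel (rooted R)) setT _ (@open (rooted R)) erefl).
move=> _ [U oU <-]; rewrite setTI.
have -> : limit_perm @^-1` U = \bigcup_h [set w |
    forall y : rooted R, restr h y = restr h (limit_perm w) -> U y].
  apply/seteqP; split=> w /= => [Uw|[h _]]; last exact.
  by have [h hU] := nbhs_restr (open_nbhs_nbhs (conj oU Uw)); exists h.
apply: bigcup_measurable => h _.
exact: (measurable_cylinder h (fun z => forall y, restr h y = z -> U y)).
Qed.

HB.instance Definition _ := isMeasurableFun.Build _ _ _ _ limit_perm measurable_limit_perm.

End limit_object.

(** * From cylinder functions to bounded continuous functions *)

Section quenched.
Variable R : realType.
Local Notation P := (unit_prob (R := R)).

Lemma perm_avg_dist (f g : rooted_perm -> R) n (s : 'S_n.+1) (a b : R) (k : rooted_perm -> R) :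
  (forall x, `|f x - g x| <= a + b * k x) ->
  `|perm_avg f s - perm_avg g s| <= a + b * perm_avg k s.
Proof.
move=> fg; rewrite /perm_avg -mulrBr -sumrB normrM ger0_norm ?invr_ge0//.
have -> : a + b * (n.+1%:R^-1 * \sum_i k (root_at s i)) =
    n.+1%:R^-1 * \sum_i (a + b * k (root_at s i)).
  rewrite big_split /= sumr_const card_ord -(mulr_natl a) mulrDr mulKf//.
  by rewrite -mulr_sumr mulrCA.
rewrite ler_pM2l ?invr_gt0//.
by apply: (le_trans (ler_norm_sum _ _ _)); apply: ler_sum => i _.
Qed.

(** Here [x] stands for a window of radius [h]; the property says that the window does not determine
    [f] up to an error [e]. *)
Definition oscillates (f : rooted R -> R) (e : R) (h : nat) (x : rooted_perm) : Prop :=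
  exists y z : rooted R, [/\ restr h y = x, restr h z = x & e < `|f y - f z|].

(** The events [S h] decrease in [h], and by continuity of [f] at each point their intersection is
    empty, so their probabilities tend to 0. *)
Lemma oscillates_small (f : rooted R -> R) (e d : R) : continuous f -> 0 < e -> 0 < d ->
  exists h, \int[P]_w `[< oscillates f e h (restr h (limit_perm w)) >]%:R <= d.
Proof.
move=> cf e0 d0.
pose S h := [set w : measurableTypeR R | oscillates f e h (restr h (limit_perm w))].
have mS h : measurable (S h) by exact: measurable_cylinder.
have S0 : \bigcap_h S h = set0.
  apply/seteqP; split=> // w Sw.
  have e20 : 0 < e / 2 by rewrite divr_gt0.
  have [h hf] := continuous_restr (limit_perm w) cf e20.
  have [y [z [/hf hy /hf hz]]] := Sw h I.
  have := ler_distD (f (limit_perm w)) (f y) (f z);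
    rewrite [`|f y - f (limit_perm w)|]distrC; lra.
have Scvg : (P \o S) n @[n --> \oo] --> P (\bigcap_h S h).
  apply: nonincreasing_cvg_mu => //.
  - by rewrite (le_lt_trans (probability_le1 _ (mS 0%N)))// ltry.
  - by rewrite S0; exact: measurable0.
  - move=> h k hk; apply/subsetPset => w [y [z [ye ze yz]]].
    by exists y, z; split=> //; [exact: restr_mono hk ye|exact: restr_mono hk ze].
rewrite S0 measure0 in Scvg.
have /fine_cvgP[_ /cvgr0_norm_lt /(_ _ d0)[N _ /(_ N (leqnn N)) /= PN]] := Scvg.
exists N; rewrite (_ : (fun w => _) = \1_(S N)); last first.
  by apply/funext => w; rewrite indicE; congr (nat_of_bool _)%:R.
rewrite /Rintegral integral_indic// setIT.
exact: le_trans (ler_norm _) (ltW PN).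
Qed.

(* [f] is replaced by its restriction to radius [h], at a cost controlled by the
   frequency of the places where [f] oscillates; that frequency is itself an
   average of a cylinder function, so its limit is the small number
   [P (oscillates f e h)]. *)
Lemma cvg_integral_root_law (f : rooted R -> R) (M : R) :
  continuous f -> (forall x, `|f x| <= M) ->
  \int[root_law p : probability (borel (rooted R)) R]_x f x @[p --> prob_filter R] -->
  \int[distribution P (limit_perm (R := R)) : probability (borel (rooted R)) R]_x f x.
Proof.
move=> cf fM.
have M0 : 0 <= M by exact: le_trans (fM point).
have mf := measurable_continuous_borel cf.
have iF : P.-integrable setT (EFin \o (fun w => f (limit_perm w))).
  have mF : measurable_fun setT (fun w : measurableTypeR R => f (limit_perm w)).
    exact: (measurableT_comp mf (@measurable_limit_perm R)).
  have bF : [bounded f (limit_perm w) | w in [set: measurableTypeR R]].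
    exists M; split; first exact: num_real.
    by move=> y My x _; apply: le_trans (fM _) (ltW My).
  apply: (measurable_bounded_integrable measurableT _ mF bF).
  exact: (le_lt_trans (probability_le1 P measurableT) (ltry 1)).
have -> : \int[distribution P (limit_perm (R := R)) : probability (borel (rooted R)) R]_x f x =
    \int[P]_w f (limit_perm w).
  rewrite /Rintegral integral_distribution//; exact/measurable_EFinP.
have -> : (fun p => \int[root_law p : probability (borel (rooted R)) R]_x f x) =
    (fun p => perm_avg f (tagged p)).
  by apply/funext => p; exact: integral_root_law fM.
apply/cvgrPdist_lt => e e0.
(* Three errors are added: [5 t] from truncating [f] in the average, [t] from the cylinder limit,
   [3 t] from truncating [f] in the integral. Their sum [9 t] stays below [e]. *)
pose t := e / 10; have t0 : 0 < t by rewrite divr_gt0.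
pose d := t / (M + 1); have d0 : 0 < d by rewrite divr_gt0// ltr_wpDl.
have Md : M * d <= t.
  by rewrite mulrA ler_pdivrMr ?ltr_wpDl// mulrC ler_wpM2l ?lerDl// ltW.
have [h small] := oscillates_small cf t0 d0.
pose k (x : rooted_perm) : R := `[< oscillates f t h x >]%:R.
have k1 x : `|k x| <= 1 by rewrite ger0_norm ?ler0n// lern1 leq_b1.
have [iG Glim] := cylinder_limit (R := R) h (G := f) fM.
have [iK Klim] := cylinder_limit h k1.
(* Both [x] and [restr h x] have the same window, so where it does not oscillate [f] changes by at
   most [t]; elsewhere the trivial bound [2 M] is used. *)
have osc x : `|f x - f (restr h x)| <= t + 2 * M * k (restr h x).
  rewrite /k; case: asboolP => [_|nosc].
    rewrite mulr1; apply: (le_trans (ler_normB _ _)).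
    by have := fM x; have := fM (restr h x); lra.
  rewrite mulr0 addr0 leNgt; apply/negP => tx; apply: nosc.
  by exists x, (restr h x); split=> //; rewrite restr_restr.
have intdist : `|\int[P]_w f (limit_perm w) - \int[P]_w f (restr h (limit_perm w))| <=
    t + 2 * M * \int[P]_w k (restr h (limit_perm w)).
  have iD := integrableB measurableT iF iG.
  rewrite -(RintegralB measurableT iF iG).
  apply: (le_trans (le_normr_Rintegral measurableT iD)).
  have iC : P.-integrable setT (EFin \o (fun=> t)) by exact: finite_measure_integrable_cst.
  have iZ := integrableZl measurableT (2 * M) iK.
  rewrite -(RintegralZl _ measurableT iK).
  have <- : \int[P]_w t = t by rewrite Rintegral_cst//= probability_setT /= mulr1.
  rewrite -(RintegralD measurableT iC iZ); apply: le_Rintegral => //.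
  - exact: (integrable_norm iD).
  - exact: (integrableD measurableT iC iZ).
have t1 := cvgr_dist_lt _ _ Glim _ t0; have t2 := cvgr_dist_lt _ _ Klim _ d0.
near=> p.
have p1 : `|\int[P]_w f (restr h (limit_perm w)) - perm_avg (f \o restr h) (tagged p)| < t.
  by near: p; exact: t1.
have p2 : `|\int[P]_w k (restr h (limit_perm w)) - perm_avg (k \o restr h) (tagged p)| < d.
  by near: p; exact: t2.
have p3 : `|perm_avg f (tagged p) - perm_avg (f \o restr h) (tagged p)| <=
    t + 2 * M * perm_avg (k \o restr h) (tagged p).
  by apply: perm_avg_dist => x; exact: osc.
have p4 : perm_avg (k \o restr h) (tagged p) <= d + d.
  have {}small : \int[P]_w k (restr h (limit_perm w)) <= d by exact: small.
  move: p2 small; move: (\int[P]_w _) (perm_avg _ _) => u v.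
  by rewrite ltr_norml => /andP[u1 _] u2; rewrite -lerBlDr; apply: le_trans u2;
    rewrite lerBlDr -lerBlDl ltW// -ltrN2 opprB.
have Mk : M * perm_avg (k \o restr h) (tagged p) <= t + t.
  by apply: (le_trans (ler_wpM2l M0 p4)); rewrite mulrDr lerD.
have Mi : M * \int[P]_w k (restr h (limit_perm w)) <= t.
  by apply: le_trans Md; apply: ler_wpM2l.
have te : e = t * 10 by rewrite /t divfK.
move: p1 p3 intdist; rewrite te ltr_norml !ler_norml.
rewrite -!(mulrA 2); move: (M * perm_avg _ _) Mk (M * \int[P]_w _) Mi => mk Mk mi Mi.
move: (perm_avg _ _) (perm_avg _ _) (\int[P]_w _) (\int[P]_w _) => u1 u2 u3 u4.
clear -Mk Mi t0.
move=> /andP[? ?] /andP[? ?] /andP[? ?]; rewrite ltr_norml; apply/andP; split; lra.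
Unshelve. all: by end_near. Qed.

End quenched.

Lemma cvg_initial (S : choiceType) (T : topologicalType) (f : S -> T) (U : Type)
    (F : set_system U) (g : U -> S) (s : S) : Filter F ->
  f (g u) @[u --> F] --> f s -> g u @[u --> F] --> (s : initial_topology f).
Proof.
move=> FF h A [_ [[B oB <-] Bfs sBA]].
have FB : F (fun u => B (f (g u))) by apply: h; exact: open_nbhs_nbhs.
by apply: filterS FB => u; exact: sBA.
Qed.

(** The weak topology is initial for a product topology, so convergence is tested on one integral at
    a time. *)
Lemma cvg_weak_prob (R : realType) (E : ptopologicalType) (U : Type) (F : set_system U)
    (g : U -> probability (borel E) R) (mu : probability (borel E) R) : Filter F ->
  (forall f : Cb R E, \int[g u]_x (sval f) x @[u --> F] --> \int[mu]_x (sval f) x) ->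
  (g u : weak_prob R E) @[u --> F] --> (mu : weak_prob R E).
Proof.
move=> FF h; apply: cvg_initial; apply/cvg_sup => f.
apply: (@cvg_initial _ R (fun F : {ptws Cb R E -> R} => F f) U F (fun u => (fun f : Cb R E
  => \int[g u]_x (sval f) x) : {ptws Cb R E -> R}) _ FF). exact: (h f).
Qed.

Unset Implicit Arguments.

Theorem corollary4p5 (R : realType)
    (d_ : nat -> measure_display) (T_ : forall n : nat, measurableType (d_ n))
    (P_ : forall n : nat, probability (T_ n) R)
    (sigma_ : forall n : nat, {RV (P_ n) >-> perms})
    (sigma_unif : forall n : nat, uniform_in (Av231 n.+1) (sigma_ n)) :
  exists (d : measure_display) (T : measurableType d) (P : probability T R)
      (sigma_oo : {RV P >-> borel (rooted R)}),
    (forall w : T, rp_infinite (sigma_oo w)) /\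
    quenched_cvg sigma_
      (cst (distribution P sigma_oo : probability (borel (rooted R)) R)
         : {RV P >-> borel (weak_prob R (rooted R))}).
Proof.
exists _, _, (unit_prob (R := R)), (@limit_perm R); split.
  by move=> w; exact: walk_rp_infinite.
set mu : probability (borel (rooted R)) R := distribution _ _.
(* The root laws converge in probability to [mu], as points of the space of measures. *)
have mu_lim : (random_root_law R p : weak_prob R (rooted R)) @[p --> prob_filter R] -->
    (mu : weak_prob R (rooted R)).
  apply: cvg_weak_prob => -[f [cf [M [_ fM]]]] /=.
  by apply: (@cvg_integral_root_law R f (M + 1) cf) => x; apply: fM => //; rewrite ltrDl.
move=> F cF [M [_ FM]].
(* Boundedness provides every constant strictly above [M], hence [M + 1]. *)
have {}FM x : `|F x| <= M + 1 by apply: FM => //; rewrite ltrDl.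
have M0 : 0 <= M + 1 by exact: le_trans (FM mu).
pose G (p : perms) : R := F (random_root_law R p).
have Glim : G p @[p --> prob_filter R] --> F mu by exact: cvg_comp mu_lim (cF mu).
have mG n : measurable_fun setT (fun w => G (sigma_ n w)).
  by apply: (@measurableT_comp _ _ _ _ _ _ G) => //.
have iG n : (P_ n).-integrable setT (EFin \o (fun w => G (sigma_ n w))).
  apply: (measurable_bounded_integrable measurableT _ (mG n)).
    exact: (le_lt_trans (probability_le1 (P_ n) measurableT) (ltry 1)).
  exists (M + 1); split; first exact: num_real.
  by move=> y My x _; apply: le_trans (FM _) (ltW My).
have -> : 'E_(unit_prob (R := R))[fun w => F ((cst mu : _ -> weak_prob R (rooted R)) w)]%E =
  (F mu)%:E.
  exact: (expectation_cst (unit_prob (R := R)) (F mu)).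
have -> : (fun n => 'E_(P_ n)[fun w => F ((random_root_law R \o sigma_ n) w)])%E =
    (fun n => (\int[P_ n]_w G (sigma_ n w))%:E).
  apply/funext => n; rewrite unlock /Rintegral fineK//.
  exact: (integrable_fin_num measurableT (iG n)).
suff Ilim : \int[P_ n]_w G (sigma_ n w) @[n --> \oo] --> F mu.
  apply: (@cvg_EFin R nat \oo _ (fun n => (\int[P_ n]_w G (sigma_ n w))%:E) (F mu)).
    exact: nearW.
  exact: Ilim.
apply/cvgrPdist_le => e e0.
have e20 : 0 < e / 2 by rewrite divr_gt0.
(* As [mu] is deterministic, convergence in probability suffices: off [bad] the deviation is below
   [e / 2], and [bad] has vanishing probability. *)
pose bad := [set p : perms | ~ (`|F mu - G p| < e / 2)].
have /= near_mu : prob_filter R [set p | `|F mu - G p| < e / 2] := cvgr_dist_lt _ _ Glim _ e20.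
have Pbad n : P_ n (sigma_ n @^-1` bad) =
    (#|Av231 n.+1 :&: [set s | `[< bad (mkperms s) >]]%SET|%:R / #|Av231 n.+1|%:R)%:E.
  by rewrite (sigma_unif n bad) finset.setIdE.
(* On [bad] the deviation is at most [2 * (M + 1)], so a probability below this quotient costs at
   most [e / 2]; the added 1 keeps the denominator positive. *)
have M20 : 0 < e / 2 / (2 * (M + 1) + 1) by rewrite divr_gt0// ltr_wpDl// mulr_ge0.
have bad0 : (#|Av231 n.+1 :&: [set s | `[< bad (mkperms s) >]]%SET|%:R / #|Av231 n.+1|%:R : R)
    @[n --> \oo] --> (0 : R) by exact: near_mu.
apply: filterS (cvgr0_norm_lt _ bad0 _ M20) => n; rewrite ger0_norm ?divr_ge0// => small.
have mbad : measurable (sigma_ n @^-1` bad).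
  by rewrite -[X in measurable X]setTI; exact: (measurable_funP (sigma_ n)).
have iB : (P_ n).-integrable setT (EFin \o \1_(sigma_ n @^-1` bad)) by exact: integrable_indic.
have iC r : (P_ n).-integrable setT (EFin \o (fun=> r)) by exact:
  finite_measure_integrable_cst.
have cstE r : \int[P_ n]_w r = r by rewrite Rintegral_cst//= probability_setT /= mulr1.
rewrite -(cstE (F mu)) -(RintegralB measurableT (iC _) (iG n)).
have iD := integrableB measurableT (iC (F mu)) (iG n).
apply: (le_trans (le_normr_Rintegral measurableT iD)).
have iZ := integrableZl measurableT (2 * (M + 1)) iB.
apply: (@le_trans _ _ (\int[P_ n]_w (e / 2 + 2 * (M + 1) * \1_(sigma_ n @^-1` bad) w))).
  apply: le_Rintegral => //; first exact: (integrable_norm iD).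
    exact: (integrableD measurableT (iC (e / 2)) iZ).
  move=> w _; rewrite indicE; have [wb|wb] := boolP (w \in _).
    rewrite mulr1; apply: (le_trans (ler_normB _ _)).
    by have := FM mu; have := FM (random_root_law R (sigma_ n w)); rewrite -/(G _); lra.
  rewrite mulr0 addr0; move: wb; rewrite notin_setE /= => /contrapT; exact: ltW.
rewrite (RintegralD measurableT (iC _) iZ) cstE (RintegralZl _ measurableT iB).
have -> : \int[P_ n]_w \1_(sigma_ n @^-1` bad) w =
    #|Av231 n.+1 :&: [set s | `[< bad (mkperms s) >]]%SET|%:R / #|Av231 n.+1|%:R.
  by rewrite /Rintegral integral_indic// setIT; exact: (congr1 fine (Pbad n)).
move: small; rewrite ltr_pdivlMr; last by rewrite ltr_wpDl// mulr_ge0.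
have : 0 <= #|Av231 n.+1 :&: [set s | `[< bad (mkperms s) >]]%SET|%:R / #|Av231 n.+1|%:R :> R.
  by rewrite divr_ge0.
move: (_ / #|Av231 n.+1|%:R) => r r0 small.
rewrite [leRHS](splitr e) lerD2l mulrC.
by apply: le_trans (ltW small); rewrite ler_wpM2l// lerDl.
Qed.
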